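(* Let $J>0$, and take $h=0$ and final magnetization $\alpha=0$. Let $\Delta_{t,0}$ be the set of global minimizers of $C_{t,0}$ on $[-1,+1]$, and (for $J>1$) let $\Psi_c=\Psi_c(J)$ be the critical time defined in the context. (i) If $0<J\le1$, then $\Delta_{t,0}=\{0\}$ for all $t\ge0$. (ii) If $1<J\le\frac32$, then $\Delta_{t,0}=\{0\}$ for $0\le t\le\Psi_c$, and $\Delta_{t,0}=\{\pm\hat m(t)\}$ for $t>\Psi_c$, where $t\mapsto\hat m(t)$ is continuous and strictly increasing on $[\Psi_c,\infty)$ with $\hat m(\Psi_c)=0$. (iii) If $J>\frac32$, then $\Delta_{t,0}=\{0\}$ for $0\le t<\Psi_c$, and $\Delta_{t,0}=\{\pm\hat m(t)\}$ for $t\ge\Psi_c$, where $t\mapsto\hat m(t)$ is continuous and strictly increasing on $[\Psi_c,\infty)$ with $\hat m(\Psi_c)=m_*>0$.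
   Context: Rate functions (for $h=0$): $I_S(m)=-\frac12Jm^2+\frac{1+m}{2}\log(1+m)+\frac{1-m}{2}\log(1-m)$ on $[-1,+1]$ (with $0\log0=0$). For a càdlàg path $\phi:[0,t]\to[-1,+1]$ let $I^t(\phi)=I_S(\phi(0))+\int_0^tL(\phi(s),\dot\phi(s))\,ds$ if $\dot\phi$ exists and $I^t(\phi)=\infty$ otherwise, where $$L(m,\dot m)=-\tfrac12\sqrt{4(1-m^2)+\dot m^2}+\tfrac12\dot m\log\Big(\frac{\sqrt{4(1-m^2)+\dot m^2}+\dot m}{2(1-m)}\Big)+1.$$ For $m\in[-1,+1]$, $C_{t,0}(m)=\inf\{I^t(\phi):\phi(0)=m,\ \phi(t)=0\}$. When $\Delta_{t,0}$ is of the form $\{\pm\hat m(t)\}$, $\hat m(t)$ denotes the unique positive global minimizer. Critical time: let $a^J(m)=\sinh(2Jm)-m\cosh(2Jm)$, $t(m)=\frac12\operatorname{arccoth}\big(a^J(m)/m\big)$ and $C_M(m)=\frac12Jm^2+\frac12\log[1-m\tanh(Jm)]$. For $1<J\le\frac32$, $\Psi_c(J)=\frac12\operatorname{arccoth}(2J-1)$. For $J>\frac32$, $\Psi_c(J)=t_*=t(m_* )$, where $m_*=m_*(J)>0$ is the solution of $C_M(m_* )=0$.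
   Formalization: In (iii), at the single time t = Ψ_c, the set of global minimizers is {0, ±m̂(Ψ_c)} instead of {±m̂(Ψ_c)}, because C_{t,0}(0) = 0 = C_M(m_* ) makes 0 a minimizer there too; the claim Δ = {±m̂(t)} is made for t > Ψ_c. *)

(* Defs.v *)
From HB Require Import structures.
From mathcomp Require Import all_boot all_order all_algebra.
From mathcomp Require Import all_classical all_reals all_analysis.
Set Implicit Arguments. Unset Strict Implicit. Unset Printing Implicit Defensive.
Import Order.TTheory GRing.Theory Num.Theory.
Import numFieldNormedType.Exports.
Local Open Scope classical_set_scope.
Local Open Scope ring_scope.

Definition sinh (R : realType) (x : R) : R := (expR x - expR (- x)) / 2.
Definition cosh (R : realType) (x : R) : R := (expR x + expR (- x)) / 2.
Definition tanh (R : realType) (x : R) : R := sinh x / cosh x.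

(* Inverse of coth on the interval 1 < x. *)
Definition arccoth (R : realType) (x : R) : R := ln ((x + 1) / (x - 1)) / 2.

(* For m in [-1, 1]; [ln 0 = 0] implements the convention 0 log 0 = 0. *)
Definition I_S (R : realType) (J m : R) : R :=
  - (J * m ^+ 2 / 2) + (1 + m) / 2 * ln (1 + m) + (1 - m) / 2 * ln (1 - m).

(* At m = 1 and m = -1 the conventions x / 0 = 0 and ln 0 = 0 give the value 1
   for v = 0, which is the limit of the formula as v -> 0 on the admissible
   side.  The values there for v <> 0 are irrelevant: a path with values in
   [-1, 1] that is differentiable at an interior time s with phi s = 1 or
   phi s = -1 has derivative 0 at s. *)
Definition lagrangian (R : realType) (m v : R) : R :=
  let q := Num.sqrt (4 * (1 - m ^+ 2) + v ^+ 2) in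
  - (q / 2) + v / 2 * ln ((q + v) / (2 * (1 - m))) + 1.

(* Paths on [0, t] are represented by total functions; only their restriction
   to [0, t] matters. *)
Definition cadlag (R : realType) (t : R) (phi : R -> R) : Prop :=
  (forall s, s \in `[0, t[ -> phi x @[x --> s^'+] --> phi s) /\
  (forall s, s \in `]0, t] -> cvg (phi x @[x --> s^'-])).

Definition abs_continuous (R : realType) (a b : R) (phi : R -> R) : Prop :=
  forall e : R, 0 < e -> exists2 d : R, 0 < d &
    forall (n : nat) (l r : nat -> R),
      (forall i, (i < n)%N -> a <= l i /\ l i <= r i /\ r i <= b) ->
      trivIset `I_n (fun i => `]l i, r i[%classic) ->
      \sum_(i < n) (r i - l i) < d ->
      \sum_(i < n) `|phi (r i) - phi (l i)| < e.

(* "The derivative of phi exists": phi is differentiable almost everywhere on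
   [0, t] and is the primitive of its derivative, i.e. is absolutely
   continuous.  Differentiability almost everywhere alone would give cost 0 to
   jumps, so that the rate function would not penalize them. *)
Definition has_derivative (R : realType) (t : R) (phi : R -> R) : Prop :=
  abs_continuous 0 t phi /\
  {ae (@lebesgue_measure R), forall s : R, s \in `]0, t[ -> derivable phi s 1}.

Definition path_rate (R : realType) (J t : R) (phi : R -> R) : \bar R :=
  if `[< has_derivative t phi >] then
    ((I_S J (phi 0))%:E +
     \int[@lebesgue_measure R]_(s in `[0%R, t])
       (lagrangian (phi s) ('D_1 phi s))%:E)%E
  else +oo%E.

Definition paths (R : realType) (t : R) : set (R -> R) :=
  [set phi | cadlag t phi /\ forall s, s \in `[0, t] -> phi s \in `[-1, 1]].

Definition cost (R : realType) (J t alpha m : R) : \bar R :=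
  ereal_inf [set path_rate J t phi |
    phi in [set phi | paths t phi /\ phi 0 = m /\ phi t = alpha]].

Definition minimizers (R : realType) (J t alpha : R) : set R :=
  [set m | m \in `[-1, 1] /\
    forall m', m' \in `[-1, 1] -> (cost J t alpha m <= cost J t alpha m')%E].

Definition aJ (R : realType) (J m : R) : R :=
  sinh (2 * J * m) - m * cosh (2 * J * m).

Definition t_of (R : realType) (J m : R) : R := arccoth (aJ J m / m) / 2.

Definition C_M (R : realType) (J m : R) : R :=
  J * m ^+ 2 / 2 + ln (1 - m * tanh (J * m)) / 2.

Definition C_M_zeros (R : realType) (J : R) : set R :=
  [set m | 0 < m <= 1 /\ C_M J m = 0].

(* The solution m > 0 of C_M J m = 0, meaningful for J > 3/2. *)
Definition m_star (R : realType) (J : R) : R := xget 0 (C_M_zeros J).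

(* The critical time, meaningful for J > 1. *)
Definition Psi_c (R : realType) (J : R) : R :=
  if J <= 3 / 2 then arccoth (2 * J - 1) / 2 else t_of J (m_star J).

(* Main.v *)
Require Import Defs.
From HB Require Import structures.
From mathcomp Require Import all_boot all_order all_algebra.
From mathcomp Require Import all_classical all_reals all_analysis.
From mathcomp Require Import measurable_realfun.
From mathcomp Require Import ring lra.
Set Implicit Arguments.
Unset Strict Implicit.
Unset Printing Implicit Defensive.
Import Order.TTheory GRing.Theory Num.Theory.
Import numFieldNormedType.Exports.
Local Open Scope classical_set_scope.
Local Open Scope ring_scope.

(** The proof makes the cost explicit by convex duality and then minimizes it by
    calculus.

    Duality. The Legendre transform of the Lagrangian in the velocity is the
    Hamiltonian [H (m, p) = (cosh (2 p) - 1) - m sinh (2 p)], which is affine in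
    [m]. If the momentum solves [p' = sinh (2 p)], that is
    [tanh (p s) = u exp (2 s)], then for every path [phi] the quantity
    [p phi' - H (phi, p)] is an exact derivative, so integrating the
    Fenchel-Young inequality bounds the cost of [phi] from below by the initial
    magnetization and [u] alone ([path_rate_ge]). This needs only half of the
    fundamental theorem of calculus for absolutely continuous functions
    ([ac_increment_le_integral]). Choosing for [u] the root [tilt] of a
    quadratic equation makes the bound sharp, as the extremal path shows
    ([cost_extremal_le]); hence, with [E = exp (4 t)], the cost equals [value J E]
    on the open interval ([cost_value]).

    Critical points. The dual bound also provides tangent bounds
    ([cost_ge_tangent]), which keep minimizers away from the endpoints and force
    the slope to vanish at a positive minimizer [m]. A vanishing slope means
    [aJ J m / m = coth (2 t)], and then the cost is [C_M J m], whatever [t] is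
    ([critical_equation], [value_at_critical]). As the cost of [0] is [0], a
    positive minimizer is a solution of [aJ J m / m = coth (2 t)] with
    [C_M J m <= 0].

    Shape. The derivatives of [C_M J] and of [aJ J m / m] have the same sign,
    that of [branch_slope], which is positive first and negative afterwards.
    Since [C_M J 0 = 0], as soon as [C_M J] is not positive both functions
    decrease strictly ([C_M_pattern], [branch_ratio_decreasing]), so each time
    admits at most one positive minimizer. It exists precisely when [coth (2 t)]
    does not exceed the value of [aJ J m / m] at the point where the admissible
    part of the branch begins: this is [m_star J] when [3/2 < J], while for
    [J <= 3/2] it is [0], where the limit [2 J - 1] is not attained. The times
    where equality holds are the critical times, and inverting the decreasing
    function [aJ J m / m] gives the continuous increasing minimizer
    ([inverse_branch]). *)

(** * Derivatives and mean values *)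

(** For the side conditions of [field]: every denominator met below is a
    product of positive factors. *)
Ltac neq0 := repeat (apply/andP; split); apply: lt0r_neq0; nra.

Lemma is_derive_ln_comp (R : realType) (f : R -> R) (x df : R) :
  0 < f x -> is_derive x 1 f df -> is_derive x 1 (fun y => ln (f y)) (df / f x).
Proof.
move=> fx0 fd; rewrite mulrC.
exact: (is_derive1_comp (is_derive1_ln fx0) fd).
Qed.

Lemma mean_value (R : realType) (f df : R -> R) (a b : R) : a < b ->
  (forall x, a <= x <= b -> is_derive x 1 f (df x)) ->
  exists2 c, a < c < b & f b - f a = df c * (b - a).
Proof.
move=> ab fd.
have [x||c cab E] := @MVT _ f df a b ab.
- by rewrite in_itv/= => /andP[ax xb]; apply: fd; rewrite !ltW.
- apply: derivable_within_continuous => x; rewrite in_itv/= => xab.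
  by have := fd x xab => ?; apply: ex_derive.
- by exists c => //; move: cab; rewrite in_itv.
Qed.

Lemma lt_of_derive_gt0 (R : realType) (f df : R -> R) (a b : R) : a < b ->
  (forall x, a <= x <= b -> is_derive x 1 f (df x)) ->
  (forall x, a < x < b -> 0 < df x) -> f a < f b.
Proof.
move=> ab fd df0; have [c cab E] := mean_value ab fd.
by rewrite -subr_gt0 E mulr_gt0 ?df0// subr_gt0.
Qed.

Lemma gt_of_derive_lt0 (R : realType) (f df : R -> R) (a b : R) : a < b ->
  (forall x, a <= x <= b -> is_derive x 1 f (df x)) ->
  (forall x, a < x < b -> df x < 0) -> f b < f a.
Proof.
move=> ab fd df0; have [c cab E] := mean_value ab fd.
by rewrite -subr_lt0 E nmulr_rlt0 ?df0// subr_gt0.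
Qed.

Lemma lipschitz_of_derive (R : realType) (f df : R -> R) (a b C : R) :
  (forall s, a <= s <= b -> is_derive s 1 f (df s)) ->
  (forall s, a <= s <= b -> `|df s| <= C) ->
  forall x y, a <= x -> x <= y -> y <= b -> `|f y - f x| <= C * (y - x).
Proof.
move=> fd dfC x y ax xy yb.
have sub s : x <= s <= y -> a <= s <= b.
  by move=> /andP[xs sy]; rewrite (le_trans ax xs) (le_trans sy yb).
have [s||c cxy ->] := @MVT_segment _ f df _ _ xy.
- by rewrite in_itv/= => /andP[xs sy]; apply: fd; apply: sub; rewrite !ltW.
- apply: derivable_within_continuous => s; rewrite in_itv/= => sxy.
  by have := fd _ (sub _ sxy); move=> ?; apply: ex_derive.
rewrite normrM (ger0_norm (_ : 0 <= y - x)) ?subr_ge0// ler_wpM2r ?subr_ge0//.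
by apply: dfC; apply: sub; move: cxy; rewrite in_itv.
Qed.

(** Difference quotients over intervals that contain [s], without being based
    at [s], also converge to the derivative. This is the form in which
    derivatives enter the covering argument of [ac_le_nondecreasing]. *)
Lemma derivable_straddle (R : realType) (H : R -> R) (s h e : R) :
  is_derive s 1 H h -> 0 < e -> exists2 d : R, 0 < d & forall x y,
    s - d < x -> x <= s -> s <= y -> y < s + d ->
    `|H y - H x - h * (y - x)| <= e * (y - x).
Proof.
move=> /is_derive1_caratheodory[g [gE gc gs]] e0.
have /cvgrPdist_lt /(_ _ e0) /nbhs_ballP[d /= d0 gd] := gc.
exists d => // x y dx xs sy yd.
have one z : s - d < z -> z < s + d -> `|H z - H s - h * (z - s)| <= e * `|z - s|.
  move=> dz zd; rewrite gE -mulrBl normrM ler_wpM2r// -gs distrC ltW//.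
  by apply: gd; rewrite /ball/= ltr_norml; apply/andP; split; lra.
have -> : H y - H x - h * (y - x) =
    (H y - H s - h * (y - s)) - (H x - H s - h * (x - s)) by ring.
apply: (le_trans (ler_normB _ _)).
have yx : `|y - s| = y - s by rewrite ger0_norm//; lra.
have xsE : `|x - s| = s - x by rewrite ler0_norm//; lra.
have := one y; have := one x; rewrite yx xsE.
have dpx : x < s + d by lra.
have dpy : s - d < y by lra.
move=> /(_ dx dpx) hx /(_ dpy yd) hy.
by rewrite (_ : e * (y - x) = e * (y - s) + e * (s - x)) ?lerD//; ring.
Qed.

(** Stated at a single point because a path is differentiable merely almost
    everywhere. *)
Lemma derive_at_local_max (R : realType) (f : R -> R) (s d : R) :
  is_derive s 1 f d -> (\forall z \near s, f z <= f s) -> d = 0.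
Proof.
move=> fd /nbhs_ballP[r /= r0 fs]; apply/eqP; apply: contrapT => /negP d0.
have e0 : 0 < `|d| / 2 by rewrite divr_gt0// normr_gt0.
have [del del0 H] := derivable_straddle fd e0.
pose z := Num.min (r / 2) (del / 2).
have z0 : 0 < z by rewrite /z lt_min; apply/andP; split; lra.
have zr : z <= r / 2 by rewrite /z ge_min lexx.
have zd : z <= del / 2 by rewrite /z ge_min lexx orbT.
have fr : f (s + z) <= f s.
  by apply: fs; rewrite /ball/= opprD addrA subrr add0r normrN gtr0_norm//; lra.
have fl : f (s - z) <= f s.
  by apply: fs; rewrite /ball/= opprB addrC subrK gtr0_norm//; lra.
have := H s (s + z); have := H (s - z) s.
rewrite (_ : s - (s - z) = z); last by ring.
rewrite (_ : s + z - s = z); last by ring.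
rewrite !ler_norml.
have [dp|dn] := ltP 0 d.
  move=> _ h; have := h ltac:(lra) ltac:(lra) ltac:(lra) ltac:(lra).
  rewrite (gtr0_norm dp); move: fr z0 dp; clear; nra.
have {}dn : d < 0 by rewrite lt_neqAle dn andbT; rewrite d0.
move=> h _; have := h ltac:(lra) ltac:(lra) ltac:(lra) ltac:(lra).
rewrite (ltr0_norm dn); move: fl z0 dn; clear; nra.
Qed.

(** * Increments of absolutely continuous functions *)

(** Made for an [f] such as the Lagrangian along a path, which has junk
    values, possibly negative, where the path is not differentiable.
    Monotonicity of the supremum of simple functions below [f] suffices, and
    the negative part of [f], which lives on the null set [N], integrates to
    [0]. *)
Lemma le_integral_off_null d (T : measurableType d) (R : realType)
    (mu : {measure set T -> \bar R}) (D N : set T) (g f : T -> \bar R) :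
  measurable D -> measurable N -> mu N = 0%E -> measurable_fun D g ->
  (forall x, D x -> 0 <= g x)%E ->
  (forall x, D x -> ~ N x -> g x <= f x)%E ->
  (\int[mu]_(x in D) g x <= \int[mu]_(x in D) f x)%E.
Proof.
move=> mD mN muN mg g0 gf.
have le_int (A B : T -> \bar R) : (forall x, D x -> 0 <= A x)%E ->
    (forall x, D x -> A x <= B x)%E ->
    (\int[mu]_(x in D) A x <= \int[mu]_(x in D) B x)%E.
  move=> A0 AB; rewrite !ge0_integralE //; last first.
    by move=> x Dx; apply: le_trans (AB _ Dx); exact: A0.
  apply/ge_ereal_sup => /= _ [h hA <-].
  apply: ereal_sup_ubound => /=; exists h => // x.
  apply: (le_trans (hA x)).
  rewrite !patchE; case: ifPn => // /set_mem; exact: AB.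
(* The negative part is below the function that is infinite on [N]. *)
have fneg0 : (\int[mu]_(x in D) f^\- x = 0)%E.
  apply/eqP; rewrite eq_le integral_ge0 // andbT.
  apply: (@le_trans _ _ (\int[mu]_(x in D) ((cst +oo%E) \_ N) x)%E).
    apply: le_int => // x Dx.
    rewrite patchE; case: ifPn => [_|/negP Nx]; first exact: leey.
    have {}Nx : ~ N x by move=> /mem_set.
    rewrite funenegE ge_max lexx andbT leeNl oppe0.
    by apply: (le_trans (g0 _ Dx)); exact: gf.
  rewrite -integral_mkcondr (ge0_negligible_integral mN (measurableI _ _ mD mN))//=.
  by rewrite setDE -setIA setICr setI0 integral_set0.
rewrite [leRHS]integralE fneg0 sube0.
rewrite (ge0_negligible_integral mN)// setDE integral_mkcondr.
apply: le_int => x Dx.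
  by rewrite patchE; case: ifPn => // _; exact: g0.
rewrite patchE; case: ifPn => [/set_mem Nx|_].
  by rewrite funeposE le_max gf.
by rewrite funeposE le_max lexx orbT.
Qed.

Lemma disjoint_itv_sum_le (R : realType) (n : nat) (l r : nat -> R)
    (U : set R) :
  open U -> (forall i, (i < n)%N -> l i <= r i) ->
  (forall i, (i < n)%N -> `]l i, r i[ `<=` U) ->
  trivIset `I_n (fun i => `]l i, r i[%classic) ->
  ((\sum_(i < n) (r i - l i))%:E <= lebesgue_measure U)%E.
Proof.
move=> oU lr lrU tI.
have -> : ((\sum_(i < n) (r i - l i))%:E =
    \sum_(i < n) lebesgue_measure (`]l i, r i[%classic : set R))%E.
  rewrite -sumEFin; apply: eq_bigr => i _.
  rewrite lebesgue_measure_itv/= lte_fin.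
  by case: ltgtP (lr i (ltn_ord i)) => // -> _; rewrite subrr.
pose F i : set R := `]l i, r i[%classic.
have mU : measurable (\big[setU/set0]_(i < n) F i).
  by rewrite -bigcup_mkord; apply: bigcup_measurable => i _; exact: measurable_itv.
have <- : (lebesgue_measure (\big[setU/set0]_(i < n) F i) =
    \sum_(i < n) lebesgue_measure (F i))%E.
  by apply: measure_semi_additive_ord_I => // i _; exact: measurable_itv.
apply: le_measure; rewrite ?inE//; first exact: open_measurable.
by rewrite -bigcup_mkord => x [i /= ni]; exact: lrU.
Qed.

Lemma ordered_itv_trivIset (R : realType) (n : nat) (l r : nat -> R) :
  (forall i j, (i < j < n)%N -> r i <= l j) ->
  trivIset `I_n (fun i => `]l i, r i[%classic).
Proof.
move=> rl i j /= ni nj [x []] /=; rewrite !in_itv/= => /andP[lix xri] /andP[ljx xrj].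
case: (ssrnat.ltngtP i j) => // ij.
- have := rl i j; rewrite ij nj => /(_ isT) ?; exfalso; lra.
- have := rl j i; rewrite ij ni => /(_ isT) ?; exfalso; lra.
Qed.

(** A covering argument. Fix [e > 0] and cover the null set [N] by an open
    set [U] so small that absolute continuity bounds by [e] the total
    increment of [G] over disjoint intervals inside [U]. Walk from [0] to
    [t]: at a point outside [N] the increment of [G] is controlled by that of
    [K] up to [e] times the length, and at a point of [N] a small step stays
    inside [U]. Since [K] is nondecreasing, its own increments over the steps
    in [U] may be discarded. The walk is a supremum argument on the set [S]
    of points that can be reached. *)
Lemma ac_le_nondecreasing (R : realType) (t : R) (G K : R -> R) (N : set R) :
  0 <= t -> abs_continuous 0 t G ->
  measurable N -> lebesgue_measure N = 0%E ->
  (forall x y : R, 0 <= x -> x <= y -> y <= t -> K x <= K y) ->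
  (forall s : R, 0 <= s <= t -> ~ N s -> forall e : R, 0 < e ->
    exists2 d : R, 0 < d & forall x y : R, 0 <= x -> y <= t ->
      s - d < x -> x <= s -> s <= y -> y < s + d ->
      G y - G x <= K y - K x + e * (y - x)) ->
  G t - G 0 <= K t - K 0.
Proof.
move=> t0 acG mN N0 ndK GK.
(* The two error terms come from points outside and inside [N]. *)
suff H (e : R) : 0 < e -> G t - G 0 <= K t - K 0 + e * t + e.
  rewrite leNgt; apply/negP => lt.
  pose e := (G t - G 0 - (K t - K 0)) / (2 * (t + 1)).
  have e0 : 0 < e by apply: divr_gt0; lra.
  have := H e e0.
  have -> : K t - K 0 + e * t + e = K t - K 0 + (G t - G 0 - (K t - K 0)) / 2.
    rewrite /e; field; lra.
  lra.
move=> e0; have [d d0 acGd] := acG _ e0.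
have [U [oU NU Ud]] : exists U : set R,
    [/\ open U, N `<=` U & (lebesgue_measure U < d%:E)%E].
  have Nfin : (lebesgue_measure N < +oo)%E by rewrite N0 ltry.
  have [U [oU NU UNd]] := lebesgue_regularity_outer mN Nfin d0.
  exists U; split => //; apply: le_lt_trans UNd.
  have mUN : measurable (U `\` N).
    by apply: measurableD => //; exact: open_measurable.
  rewrite -[in leLHS](setDUK NU) measureU// ?setDIK//.
  by rewrite [X in (X + _)%E]N0 add0e.
pose S : set R := [set x | 0 <= x <= t /\ exists n (l r : nat -> R),
  [/\ forall i, (i < n)%N -> [/\ 0 <= l i, l i <= r i & r i <= x],
      forall i, (i < n)%N -> `]l i, r i[ `<=` U,
      forall i j, (i < j < n)%N -> r i <= l j &
      G x - G 0 <= K x - K 0 + e * x + \sum_(i < n) `|G (r i) - G (l i)|]].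
have step c : 0 <= c <= t -> exists2 del, 0 < del & forall x y, S x ->
    c - del < x -> x <= c -> c <= y -> y < c + del -> y <= t -> S y.
  move=> ct; have [Nc|Nc] := pselect (N c).
  - have /nbhs_ballP[del /= del0 cU] : nbhs c U by apply: open_nbhs_nbhs; split => //; exact: NU.
    exists del => // x y [xt [n [l [r [lr lrU rl Gx]]]]] dx xc cy yd yt.
    split; first by lra.
    exists n.+1, (fun i => if (i < n)%N then l i else x),
                 (fun i => if (i < n)%N then r i else y); split.
    + move=> i; case: ifP => [ni _|_ _]; last by split; lra.
      have [? ? ?] := lr _ ni; split => //; lra.
    + move=> i; case: ifP => [ni _|_ _]; first exact: lrU.
      move=> z /=; rewrite in_itv/= => /andP[xz zy]; apply: cU.
      by rewrite /ball/= ltr_norml; apply/andP; split; lra.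
    + move=> i j /andP[ij]; rewrite ltnS leq_eqVlt => /predU1P[jn|jn].
        subst j; rewrite ij ltnn; by have [] := lr _ ij.
      by rewrite jn (ltn_trans ij jn); apply: rl; rewrite ij.
    + rewrite big_ord_recr/= ltnn.
      under eq_bigr do rewrite ltn_ord.
      have Kxy : K x <= K y by apply: ndK; lra.
      have Gxy : G y - G x <= `|G y - G x| by exact: ler_norm.
      have exy : e * x <= e * y by rewrite ler_pM2l//; lra.
      lra.
  - have [del del0 H] := GK c ct Nc e e0.
    exists del => // x y [xt [n [l [r [lr lrU rl Gx]]]]] dx xc cy yd yt.
    split; first by lra.
    exists n, l, r; split => //.
      by move=> i ni; have [? ? ?] := lr _ ni; split => //; lra.
    have : G y - G x <= K y - K x + e * (y - x) by apply: H => //; lra.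
    rewrite mulrBr; lra.
have S0 : S 0.
  split; first by rewrite lexx.
  exists 0%N, (fun=> 0), (fun=> 0); split => //.
  rewrite big_ord0; lra.
have St : S t.
  have supS : has_sup S by split; [exists 0|exists t => x [/andP[]]].
  pose c := sup S.
  have ct : 0 <= c <= t.
    apply/andP; split; first by apply: ub_le_sup => //; case: supS.
    by apply: ge_sup; [exists 0|move=> x [/andP[]]].
  have [del del0 H] := step c ct.
  have [x Sx cx] := sup_adherent del0 supS.
  have xc : x <= c by apply: ub_le_sup => //; case: supS.
  pose y := Num.min t (c + del / 2).
  have Sy : S y.
    apply: (H x) => //.
    - by rewrite /y le_min; apply/andP; split; lra.
    - by rewrite /y gt_min; apply/orP; right; lra.
    - by rewrite /y ge_min lexx.
  have : y <= c by apply: ub_le_sup => //; case: supS.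
  rewrite /y ge_min => /orP[tc|]; last by lra.
  by move: Sy; rewrite /y; suff -> : Num.min t (c + del / 2) = t by []; apply/min_idPl; lra.
case: St => _ [n [l [r [lr lrU rl Gt]]]].
have tI := ordered_itv_trivIset rl.
have : \sum_(i < n) `|G (r i) - G (l i)| < e.
  apply: acGd => //.
    by move=> i ni; have [? ? ?] := lr i ni.
  rewrite -lte_fin; have lr' i : (i < n)%N -> l i <= r i.
    by move=> ni; have [] := lr i ni.
  exact: (le_lt_trans (disjoint_itv_sum_le oU lr' lrU tI) Ud).
lra.
Qed.

Lemma clamp_increment (R : realType) (t a b : R) : 0 <= t -> a <= b ->
  0 <= Num.min t (Num.max 0 b) - Num.min t (Num.max 0 a) <= b - a.
Proof.
move=> t0 ab.
case: (leP a 0) => a0; case: (leP b 0) => b0; last 2 first.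
- lra.
- case: (leP t a) => ta; case: (leP t b) => tb; lra.
- rewrite (min_idPr t0); lra.
- rewrite (min_idPr t0); case: (leP t b) => tb; lra.
Qed.

(** Clamping the argument extends [G] continuously to the whole line, so that
    the difference quotients of the extension are measurable. *)
Lemma clamp_ac_continuous (R : realType) (t : R) (G : R -> R) :
  0 <= t -> abs_continuous 0 t G ->
  continuous (fun s : R => G (Num.min t (Num.max 0 s))).
Proof.
move=> t0 acG s; apply/cvgrPdist_lt => e e0.
have [d d0 H] := acG _ e0.
near=> x.
pose c (y : R) := Num.min t (Num.max 0 y).
have c0t y : 0 <= c y <= t.
  by rewrite /c le_min t0 le_max lexx/= ge_min lexx.
have cd a b : a <= b -> c a <= c b /\ c b - c a <= b - a.
  by move=> /(clamp_increment t0)/andP[]; rewrite subr_ge0.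
have ab_small a b : a <= b -> b - a < d -> `|G (c b) - G (c a)| < e.
  move=> ab bad.
  have := H 1%N (fun=> c a) (fun=> c b); rewrite !big_ord1; apply.
  - move=> i _; have /andP[? ?] := c0t a; have /andP[? ?] := c0t b.
    by have [? ?] := cd _ _ ab.
  - by move=> i j /=; rewrite !ltnS !leqn0 => /eqP -> /eqP ->.
  - have [_] := cd _ _ ab; lra.
rewrite -/(c s) -/(c x).
have sx : `|s - x| < d by near: x; apply: cvgr_dist_lt.
have [le|/ltW le] := leP s x.
- by rewrite distrC; apply: ab_small => //; move: sx; rewrite ltr_norml; lra.
- by apply: ab_small => //; move: sx; rewrite ltr_norml; lra.
Unshelve. all: by end_near. Qed.

Lemma cvg_difference_quotient (R : realType) (H : R -> R) (s h : R) :
  is_derive s 1 H h ->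
  (n.+1%:R * (H (s + n.+1%:R^-1) - H s)) @[n --> \oo] --> h.
Proof.
move=> /is_derive1_caratheodory[g [gE gc gs]].
rewrite (_ : (fun n => _) = (fun n : nat => g (s + n.+1%:R^-1))); last first.
  apply/funext => n; rewrite gE (_ : s + n.+1%:R^-1 - s = n.+1%:R^-1); last by ring.
  by rewrite mulrCA divff ?mulr1// pnatr_eq0.
have cvs : (s + n.+1%:R^-1) @[n --> \oo] --> s.
  rewrite -[X in _ --> X]addr0; apply: cvgD; first exact: cvg_cst.
  exact: cvg_harmonic.
rewrite -gs; exact: (cvg_comp _ _ cvs gc).
Qed.

(** Half of the fundamental theorem of calculus for absolutely continuous
    functions. The positive part of the derivative is measurable, being
    almost everywhere a limit of difference quotients. Unless its integral is
    infinite, its primitive [K] is nondecreasing and has it as derivative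
    almost everywhere, by the Lebesgue differentiation theorem, so
    [ac_le_nondecreasing] compares [G] with [K]. *)
Lemma ac_increment_le_integral (R : realType) (t : R) (G F : R -> R) :
  0 <= t -> abs_continuous 0 t G ->
  {ae @lebesgue_measure R, forall s : R, s \in `]0, t[ ->
     [/\ derivable G s 1, 'D_1 G s <= F s & 0 <= F s]} ->
  ((G t - G 0)%:E <= \int[@lebesgue_measure R]_(s in `[0%R, t]) (F s)%:E)%E.
Proof.
move=> t0 acG [N0 [mN0 N00 goodN0]].
(* The endpoints join the null set because nothing is assumed there. *)
pose N := N0 `|` [set 0] `|` [set t].
have mN : measurable N by apply: measurableU => //; apply: measurableU.
have NE : lebesgue_measure N = 0%E.
  have N1 : lebesgue_measure (N0 `|` [set 0 : R]) = 0%E.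
    by rewrite measureU0//; exact: lebesgue_measure_set1.
  by rewrite /N measureU0//; [exact: measurableU|exact: lebesgue_measure_set1].
have good s : 0 <= s <= t -> ~ N s ->
    [/\ derivable G s 1, 'D_1 G s <= F s, 0 <= F s & 0 < s < t].
  move=> /andP[s0 st] Ns.
  have s0t : 0 < s < t.
    by rewrite !lt_neqAle s0 st !andbT; apply/andP; split; apply/eqP => E;
      apply: Ns; rewrite /N /=; [left; right|right].
  suff [? ? ?] : [/\ derivable G s 1, 'D_1 G s <= F s & 0 <= F s] by split.
  apply: contrapT => bad; apply: Ns; left; left; apply: goodN0 => /= H.
  by apply: bad; apply: H; rewrite in_itv.
pose Gc (s : R) := G (Num.min t (Num.max 0 s)).
have cGc : continuous Gc by exact: clamp_ac_continuous.
have Gcid s : 0 <= s <= t -> Gc s = G s.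
  by move=> /andP[s0 st]; rewrite /Gc (max_idPr _)// (min_idPr _).
pose D (n : nat) (s : R) := n.+1%:R * (Gc (s + n.+1%:R^-1) - Gc s).
pose k (s : R) : R := Num.max 0 (fine (limn_esup (fun n => (D n s)%:E))).
have mD n : measurable_fun setT (D n).
  apply: continuous_measurable_fun => s.
  apply: cvgM; first exact: cvg_cst.
  apply: cvgB; last exact: cGc.
  have shift : x + n.+1%:R^-1 @[x --> s] --> s + n.+1%:R^-1.
    by apply: cvgD; [exact: cvg_id|exact: cvg_cst].
  exact: (cvg_comp _ _ shift (cGc _)).
have mk : measurable_fun setT k.
  apply: measurable_maxr => //.
  apply: (@measurableT_comp _ _ _ _ _ _ fine) => //.
  by apply: measurable_fun_limn_esup => n; exact/measurable_EFinP.
have k0 s : 0 <= k s by rewrite /k le_max lexx.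
have kE s : 0 <= s <= t -> ~ N s -> k s = Num.max 0 ('D_1 G s).
  move=> st Ns; have [dG _ _ /andP[s0 st']] := good _ st Ns.
  rewrite /k; congr Num.max.
  have dGc : is_derive s 1 Gc ('D_1 G s).
    apply: (near_eq_is_derive _ (derivableP dG)).
    near=> y; apply/esym/Gcid/andP; split; apply/ltW; near: y.
      exact: lt_nbhsr.
    exact: lt_nbhsl.
  have H : (fun n => (D n s)%:E) @ \oo --> ('D_1 G s)%:E.
    apply: cvg_EFin; first by near=> n.
    exact: cvg_difference_quotient.
  rewrite is_cvg_limn_esupE; last by apply/cvg_ex; exists ('D_1 G s)%:E.
  by move/cvg_lim : H => ->.
have le1 : (\int[@lebesgue_measure R]_(s in `[0%R, t]) (k s)%:E <=
            \int[@lebesgue_measure R]_(s in `[0%R, t]) (F s)%:E)%E.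
  apply: (@le_integral_off_null _ _ _ _ _ N) => //.
  - by apply: measurable_funTS; exact/measurable_EFinP.
  - by move=> s _; rewrite lee_fin.
  - by move=> s /=; rewrite in_itv/= => st Ns; rewrite kE// lee_fin ge_max;
      have [_ -> ->] := good s st Ns.
apply: le_trans le1.
pose I : set R := `[0, t]%classic.
have mI : measurable I by exact: measurable_itv.
have [->|Ifin] := eqVneq (\int[@lebesgue_measure R]_(s in I) (k s)%:E)%E +oo%E.
  by rewrite leey.
have ik : (@lebesgue_measure R).-integrable I (EFin \o k).
  apply/integrableP; split; first by apply: measurable_funTS; exact/measurable_EFinP.
  rewrite ltey (_ : integral _ _ _ = (\int[@lebesgue_measure R]_(s in I) (k s)%:E)%E)//.
  by apply: eq_integral => s _ /=; rewrite ger0_norm.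
pose f := k \_ I.
have f0 s : 0 <= f s by rewrite /f patchE; case: ifP.
have if_ : (@lebesgue_measure R).-integrable setT (EFin \o f).
  rewrite /f -restrict_EFin; apply/integrable_restrict => //.
  by rewrite setTI.
have ifS A : measurable A -> (@lebesgue_measure R).-integrable A (EFin \o f).
  by move=> mA; apply: (integrableS _ _ _ if_).
have lf : locally_integrable setT f by exact: integrable_locally.
pose K x := (\int[@lebesgue_measure R]_(s in `]-oo, x]) f s)%R.
have [M [mM M0 FTC]] := FTC1Ny (fun y => ifS _ (measurable_itv _)) lf.
have Kfin (A : set R) : measurable A ->
    (\int[@lebesgue_measure R]_(s in A) (f s)%:E)%E \is a fin_num.
  by move=> mA; apply: integrable_fin_num => //; exact: ifS.
have Kle (A B : set R) : measurable A -> measurable B -> A `<=` B ->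
    (\int[@lebesgue_measure R]_(s in A) (f s)%:E <=
     \int[@lebesgue_measure R]_(s in B) (f s)%:E)%E.
  move=> mA mB AB; apply: ge0_subset_integral => //.
    by apply/measurable_EFinP; have /integrableP[/measurable_EFinP] := ifS _ mB.
  by move=> x _; rewrite lee_fin.
have ndK x y : x <= y -> K x <= K y.
  move=> xy; apply: fine_le; rewrite ?Kfin//; apply: Kle => //.
  by move=> z /=; rewrite !in_itv/= => /le_trans; apply.
apply: (@le_trans _ _ (K t)%:E); last first.
  rewrite fineK ?Kfin//; apply: (@le_trans _ _ (\int[@lebesgue_measure R]_s (f s)%:E)%E).
    exact: Kle.
  by rewrite (_ : (fun s => (f s)%:E) = (EFin \o k) \_ I) -?integral_mkcond// restrict_EFin.
have K00 : 0 <= K 0 by apply: fine_ge0; apply: integral_ge0 => x _; rewrite lee_fin.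
rewrite lee_fin; apply: (@le_trans _ _ (K t - K 0)); last by rewrite lerBlDr lerDl.
apply: (@ac_le_nondecreasing _ t G K (N `|` M)) => //.
- exact: measurableU.
- by rewrite measureU0.
- by move=> x y _ xy _; exact: ndK.
move=> s st NMs e e0.
have Ns : ~ N s by move=> ?; apply: NMs; left.
have [dK K's] : derivable K s 1 /\ derive1 K s = f s.
  by apply: contrapT => bad; apply: NMs; right; exact: FTC.
have [dG _ _ _] := good s st Ns.
have dKG : is_derive s 1 (G - K) ('D_1 G s - f s).
  rewrite -K's derive1E.
  by apply: is_deriveB; exact: derivableP.
have [d d0 H] := derivable_straddle dKG e0.
exists d => // x y x0 yt dx xs sy yd.
have xy : x <= y by exact: le_trans xs sy.
have := H x y dx xs sy yd; rewrite ler_norml => /andP[_].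
have : ('D_1 G s - f s) * (y - x) <= 0.
  apply: mulr_le0_ge0; last by rewrite subr_ge0.
  by rewrite subr_le0 /f patchE mem_set ?kE ?le_max ?lexx ?orbT// /I/= in_itv.
rewrite /= !fctE; lra.
Unshelve. all: by end_near. Qed.

Lemma ac_of_increment_le (R : realType) (a b A B : R) (phi G : R -> R) :
  0 <= A -> 0 <= B -> abs_continuous a b phi ->
  (forall x y, a <= x -> x <= y -> y <= b ->
    `|G y - G x| <= A * `|phi y - phi x| + B * (y - x)) ->
  abs_continuous a b G.
Proof.
move=> A0 B0 acphi GAB e e0.
have e1 : 0 < e / (2 * (A + 1)) by apply: divr_gt0 => //; lra.
have e2 : 0 < e / (2 * (B + 1)) by apply: divr_gt0 => //; lra.
have [d1 d10 H] := acphi _ e1.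
exists (Num.min d1 (e / (2 * (B + 1)))); first by rewrite lt_min d10.
move=> n l r lr tI; rewrite lt_min => /andP[sd1 sd2].
have {H} S1 := H n l r lr tI sd1.
apply: (@le_lt_trans _ _ (A * (\sum_(i < n) `|phi (r i) - phi (l i)|) +
   B * \sum_(i < n) (r i - l i))).
  rewrite !mulr_sumr -big_split/=; apply: ler_sum => i _.
  by have [? [? ?]] := lr i (ltn_ord i); apply: GAB.
have S10 : 0 <= \sum_(i < n) `|phi (r i) - phi (l i)| by apply: sumr_ge0.
have S20 : 0 <= \sum_(i < n) (r i - l i).
  by apply: sumr_ge0 => i _; rewrite subr_ge0; have [? [? ?]] := lr i (ltn_ord i).
move: S1 sd2 S10 S20; set s1 := \sum_(i < n) `| _ |; set s2 := \sum_(i < n) _.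
rewrite !ltr_pdivlMr; [|lra|lra].
clear -A0 B0 e0; nra.
Qed.

(** * The Lagrangian and its Legendre transform *)

Lemma ln_le_sub1 (R : realType) (z : R) : 0 < z -> ln z <= z - 1.
Proof.
move=> z0; rewrite -{1}(subrK 1 z) addrC le_ln1Dx//; lra.
Qed.

(** The tangent line of [x ln x] at [y]; with [ln 0 = 0] it also holds at [x
    = 0]. *)
Lemma xlnx_tangent_le (R : realType) (x y : R) : 0 <= x -> 0 < y ->
  x * ln y + x - y <= x * ln x.
Proof.
move=> x0 y0; have [->|xn0] := eqVneq x 0; first by rewrite !mul0r add0r; lra.
have xp : 0 < x by rewrite lt_neqAle eq_sym xn0.
have := ln_le_sub1 (divr_gt0 y0 xp); rewrite ln_div ?posrE// => h.
have : x * (ln y - ln x) <= x * (y / x - 1) by rewrite ler_pM2l.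
rewrite mulrBr [x * (y / x - 1)]mulrBr mulrCA divff// mulr1; lra.
Qed.

Definition artanh (R : realType) (u : R) : R := ln ((1 + u) / (1 - u)) / 2.

Lemma artanhE (R : realType) (u : R) : -1 < u -> u < 1 ->
  artanh u = (ln (1 + u) - ln (1 - u)) / 2.
Proof. by move=> u1 u2; rewrite /artanh ln_div// posrE; lra. Qed.

Lemma is_derive_artanh_comp (R : realType) (f : R -> R) (x df : R) :
  -1 < f x < 1 -> is_derive x 1 f df ->
  is_derive x 1 (fun y => artanh (f y)) (df / (1 - f x ^+ 2)).
Proof.
move=> /andP[f1 f2] fd; rewrite /artanh.
have g1 : 0 < 1 - f x by lra.
have g2 : 0 < 1 + f x by lra.
have g3 : 0 < (1 + f x) / (1 - f x) by apply: divr_gt0.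
have -> : df / (1 - f x ^+ 2) =
   ((df * (1 - f x) + (1 + f x) * df) / (1 - f x) ^+ 2 / ((1 + f x) / (1 - f x))) / 2.
  field; neq0.
have dq : is_derive x 1 (fun y => (1 + f y) / (1 - f y))
   ((df * (1 - f x) + (1 + f x) * df) / (1 - f x) ^+ 2).
  have n1 : 1 - f x != 0 by exact: lt0r_neq0.
  apply: is_derive_eq.
  rewrite /GRing.scale/=. field; neq0.
have := @is_derive_ln_comp _ (fun y => (1 + f y) / (1 - f y)) _ _ g3 dq => dl.
apply: is_derive_eq.
rewrite /GRing.scale/=. field; neq0.
Qed.

(** Fenchel-Young inequality between [lagrangian] and the Hamiltonian [(cosh
    (2 p) - 1) - m sinh (2 p)], for [p = artanh u]; the hyperbolic functions
    of [2 p] are the rational functions of [u] that appear here. Writing the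
    Lagrangian with [q = sqrt (4 (1 - m ^+ 2) + v ^+ 2)] and the ratio [z] of
    [exp (2 p)] to its optimal value, the gap is a combination of [z - 1 - ln
    z] and [z^-1 - 1 + ln z] with the nonnegative weights [q + v] and [q -
    v]. At [m = 1] and [m = -1] a path differentiable at an interior time has
    velocity [v = 0]. *)
Lemma legendre_le (R : realType) (m v u : R) :
  -1 < u -> u < 1 -> (-1 < m /\ m < 1) \/ ((m = 1 \/ m = -1) /\ v = 0) ->
  artanh u * v - (2 * u ^+ 2 - 2 * m * u) / (1 - u ^+ 2) <= lagrangian m v.
Proof.
move=> u1 u2; have u3 : 0 < 1 - u ^+ 2 by nra.
have d1 : 0 < 1 - u by lra.
have d2 : 0 < 1 + u by lra.
case=> [[m1 m2]|[[->|->] ->]]; last 2 first.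
- rewrite /lagrangian expr1n subrr !mulr0 expr0n/= addr0 sqrtr0 !mul0r ?oppr0 !add0r.
  rewrite lerNl ler_pdivlMr//; nra.
- rewrite /lagrangian sqrrN expr1n subrr !mulr0 expr0n/= addr0 sqrtr0 !mul0r ?oppr0 !add0r.
  rewrite lerNl ler_pdivlMr//; nra.
rewrite /lagrangian; set D := 4 * (1 - m ^+ 2) + v ^+ 2; set q := Num.sqrt D.
have Dv : v ^+ 2 < D by rewrite /D; nra.
have q2 : q ^+ 2 = D by rewrite sqr_sqrtr//; nra.
have q0 : 0 <= q by exact: sqrtr_ge0.
have qv1 : 0 < q + v by nra.
have qv2 : 0 < q - v by nra.
have m3 : 0 < 1 - m by lra.
pose x := (1 + u) / (1 - u); pose x0 := (q + v) / (2 * (1 - m)).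
have xp : 0 < x by apply: divr_gt0.
have x0p : 0 < x0 by apply: divr_gt0 => //; lra.
pose z := x / x0.
have zp : 0 < z by apply: divr_gt0.
have xE : ln x = ln x0 + ln z by rewrite -lnM ?posrE// /z mulrC divfK// gt_eqF.
have z1 := ln_le_sub1 zp.
have z2 : - ln z <= z^-1 - 1 by rewrite -lnV ?posrE//; apply: ln_le_sub1; rewrite invr_gt0.
rewrite /artanh -/x -/x0 xE.
have E1 : (q + v) * z = 2 * (1 - m) * x.
  rewrite /z /x0; field; neq0.
have E2 : (q - v) * z^-1 = 2 * (1 + m) / x.
  have qq : (q + v) * (q - v) = 4 * (1 - m) * (1 + m).
    by rewrite (_ : _ * _ = q ^+ 2 - v ^+ 2); [rewrite q2 /D; ring|ring].
  have -> : z^-1 = (q + v) / (2 * (1 - m)) / x by rewrite /z invfM invrK mulrC.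
  rewrite !mulrA [(q - v) * _]mulrC qq; field; neq0.
have E3 : (2 * u ^+ 2 - 2 * m * u) / (1 - u ^+ 2) =
   ((1 - m) * x + (1 + m) / x) / 2 - 1.
  rewrite /x; field; neq0.
have h1 : (q + v) * ln z <= (q + v) * (z - 1) by rewrite ler_pM2l.
have h2 : (q - v) * - ln z <= (q - v) * (z^-1 - 1) by rewrite ler_pM2l.
rewrite E3; lra.
Qed.

(** The hypothesis on [v] says that it is the derivative of the Hamiltonian
    in [p], where the Fenchel-Young gap closes. *)
Lemma legendre_eq (R : realType) (m v u : R) :
  -1 < u -> u < 1 -> -1 < m -> m < 1 ->
  v * (1 - u ^+ 2) = 4 * u - 2 * m * (1 + u ^+ 2) ->
  lagrangian m v = artanh u * v - (2 * u ^+ 2 - 2 * m * u) / (1 - u ^+ 2).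
Proof.
move=> u1 u2 m1 m2 vE; have u3 : 0 < 1 - u ^+ 2 by nra.
have d1 : 0 < 1 - u by lra.
have d2 : 0 < 1 + u by lra.
have m3 : 0 < 1 - m by lra.
pose q := (2 + 2 * u ^+ 2 - 4 * m * u) / (1 - u ^+ 2).
have {}vE : v = (4 * u - 2 * m * (1 + u ^+ 2)) / (1 - u ^+ 2).
  by rewrite -vE mulfK// gt_eqF.
have q0 : 0 <= q.
  apply: divr_ge0; last by lra.
  have -> : 2 + 2 * u ^+ 2 - 4 * m * u = (1 + m) * (1 - u) ^+ 2 + (1 - m) * (1 + u) ^+ 2 by ring.
  by apply: addr_ge0; apply: mulr_ge0; rewrite ?sqr_ge0//; lra.
(* The radicand is a perfect square on the graph of the derivative. *)
have qE : Num.sqrt (4 * (1 - m ^+ 2) + v ^+ 2) = q.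
  rewrite (_ : 4 * (1 - m ^+ 2) + v ^+ 2 = q ^+ 2) ?sqrtr_sqr ?ger0_norm//.
  rewrite vE /q; field; neq0.
rewrite /lagrangian qE.
have -> : (q + v) / (2 * (1 - m)) = (1 + u) / (1 - u).
  rewrite /q vE; field; neq0.
rewrite /artanh.
have -> : q / 2 = 1 + (2 * u ^+ 2 - 2 * m * u) / (1 - u ^+ 2).
  rewrite /q; field; neq0.
ring.
Qed.

Lemma artanhN (R : realType) (u : R) : -1 < u < 1 -> artanh (- u) = - artanh u.
Proof. move=> /andP[u1 u2]; rewrite artanhE; [rewrite artanhE// opprK; lra|lra|lra]. Qed.

Lemma artanh_lt0 (R : realType) (u : R) : -1 < u -> u < 0 -> artanh u < 0.
Proof.
move=> u1 u0; rewrite /artanh pmulr_llt0//; apply: ln_lt0; apply/andP; split.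
  by apply: divr_gt0; lra.
by rewrite ltr_pdivrMr; lra.
Qed.

Lemma artanh_continuous_at (R : realType) (T : topologicalType) (f : T -> R) (x : T) :
  -1 < f x < 1 -> {for x, continuous f} -> {for x, continuous (fun y => artanh (f y))}.
Proof.
move=> fx cf.
have : {for f x, continuous (@artanh R)}.
  apply: differentiable_continuous; apply/derivable1_diffP.
  have h : is_derive (f x) 1 (@artanh R) (1 / (1 - f x ^+ 2)).
    exact: (@is_derive_artanh_comp R id (f x) 1 fx (is_derive_id _ _)).
  exact: ex_derive.
exact: continuous_comp.
Qed.

(** * Lower bound for the cost of a path *)

Section Momentum.
Context (R : realType) (t u : R).
Hypothesis t0 : 0 <= t.
Hypothesis u1 : expR (4 * t) * u ^+ 2 < 1.

(** The hyperbolic tangent of the momentum. *)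
Let U (s : R) : R := u * expR (2 * s).

Lemma expR4_sq (s : R) : expR (4 * s) = expR (2 * s) ^+ 2.
Proof. by rewrite expr2 -expRD; congr expR; ring. Qed.

Lemma tanh_momentum_sq_le (s : R) : s <= t -> U s ^+ 2 <= expR (4 * t) * u ^+ 2.
Proof.
move=> st; rewrite /U exprMn mulrC -expR4_sq ler_wpM2r ?sqr_ge0// ler_expR; lra.
Qed.

Lemma tanh_momentum_itv (s : R) : s <= t -> -1 < U s < 1.
Proof.
move=> st; have h := le_lt_trans (tanh_momentum_sq_le st) u1.
by apply/andP; split; nra.
Qed.

Lemma is_derive_tanh_momentum (s : R) : is_derive s 1 U (2 * U s).
Proof. by rewrite /U; apply: is_derive_eq; rewrite /GRing.scale/=; ring. Qed.

Lemma is_derive_momentum (s : R) : s <= t ->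
  is_derive s 1 (fun s => artanh (U s)) (2 * U s / (1 - U s ^+ 2)).
Proof.
move=> st; apply: is_derive_artanh_comp; first exact: tanh_momentum_itv.
exact: is_derive_tanh_momentum.
Qed.

Lemma is_derive_ln_momentum (s : R) : s <= t ->
  is_derive s 1 (fun s => ln (1 - U s ^+ 2) / 2)
    (- (2 * U s ^+ 2 / (1 - U s ^+ 2))).
Proof.
move=> st; have /andP[U1 U2] := tanh_momentum_itv st.
have g : 0 < 1 - U s ^+ 2 by nra.
have dU := is_derive_tanh_momentum s.
have d1 : is_derive s 1 (fun s => 1 - U s ^+ 2) (- (4 * U s ^+ 2)).
  by apply: is_derive_eq; rewrite /GRing.scale/=; ring.
have := is_derive_ln_comp (f := fun s => 1 - U s ^+ 2) g d1 => dl.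
by apply: is_derive_eq; rewrite /GRing.scale/=; field; neq0.
Qed.

(** The Hamiltonian is affine in the magnetization, so along a momentum [p]
    with [p' = sinh (2 p)], that is [tanh (p s) = u exp (2 s)], the lower
    bound [p phi' - H] for the Lagrangian is exactly the derivative of [p phi
    + ln (1 - tanh p ^+ 2) / 2], whatever the path is. Only the boundary
    values remain after integration. *)
Lemma path_rate_ge (J m : R) (phi : R -> R) :
  paths t phi -> phi 0 = m -> phi t = 0 ->
  ((I_S J m + (ln ((1 - expR (4 * t) * u ^+ 2) / (1 - u ^+ 2)) / 2
     - m * artanh u))%:E <= path_rate J t phi)%E.
Proof.
move=> [_ phi1] phi0 phit; rewrite /path_rate.
case: ifPn => [/asboolP[acphi dphi]|_]; last exact: leey.
rewrite EFinD phi0 leeD2l//.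
pose G (s : R) := artanh (U s) * phi s + ln (1 - U s ^+ 2) / 2.
have phi_itv s : 0 <= s <= t -> -1 <= phi s <= 1.
  by move=> st; have := phi1 s; rewrite !in_itv/=; apply.
have U0 : U 0 = u by rewrite /U mulr0 expR0 mulr1.
have Ut : U t ^+ 2 = expR (4 * t) * u ^+ 2 by rewrite /U exprMn -expR4_sq mulrC.
have uu : 0 < 1 - u ^+ 2.
  by have /andP[] := tanh_momentum_itv t0; rewrite U0; nra.
have g0 : 0 < 1 - expR (4 * t) * u ^+ 2 by rewrite subr_gt0.
have -> : ln ((1 - expR (4 * t) * u ^+ 2) / (1 - u ^+ 2)) / 2 - m * artanh u = G t - G 0.
  rewrite /G phi0 phit mulr0 add0r Ut U0 ln_div ?posrE//.
  by field.
pose C := 2 / (1 - expR (4 * t) * u ^+ 2).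
have C0 : 0 <= C by apply: divr_ge0; lra.
have bnd s (z : R) : 0 <= s <= t -> `|z| <= 1 -> `|2 * z / (1 - U s ^+ 2)| <= C.
  move=> /andP[_ st] z1; have Us := tanh_momentum_sq_le st.
  have gs : 0 < 1 - U s ^+ 2 by lra.
  rewrite !normrM normfV normr_nat (gtr0_norm gs) /C ler_pdivrMr//.
  rewrite mulrAC ler_pdivlMr//.
  have : `|z| * (1 - expR (4 * t) * u ^+ 2) <= 1 * (1 - expR (4 * t) * u ^+ 2).
    by rewrite ler_wpM2r// ltW.
  lra.
have Unorm s : 0 <= s <= t -> `|U s| <= 1.
  by move=> /andP[_ st]; have := tanh_momentum_itv st; rewrite -ltr_norml => /ltW.
have LP := lipschitz_of_derive (a := 0) (b := t) (C := C)
  (fun s (st : 0 <= s <= t) => is_derive_momentum (proj2 (andP st)))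
  (fun s st => bnd s _ st (Unorm s st)).
have LQ x y : 0 <= x -> x <= y -> y <= t ->
   `|ln (1 - U y ^+ 2) / 2 - ln (1 - U x ^+ 2) / 2| <= C * (y - x).
  apply: (@lipschitz_of_derive _ (fun s => ln (1 - U s ^+ 2) / 2)
    (fun s => - (2 * U s ^+ 2 / (1 - U s ^+ 2))) 0 t C).
    by move=> s /andP[_ st]; exact: is_derive_ln_momentum.
  move=> s st; rewrite normrN; apply: bnd => //.
  by rewrite normrX exprn_ile1// Unorm.
have Pbnd s : 0 <= s <= t -> `|artanh (U s)| <= `|artanh u| + C * t.
  move=> /andP[s0 st]; have := LP 0 s (lexx _) s0 st; rewrite U0 subr0.
  move=> H; have Cst : C * s <= C * t by rewrite ler_wpM2l.
  rewrite (_ : artanh (U s) = artanh u + (artanh (U s) - artanh u)); last by ring.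
  apply: (le_trans (ler_normD _ _)); rewrite lerD2l.
  exact: le_trans H Cst.
apply: ac_increment_le_integral => //.
  apply: (@ac_of_increment_le _ 0 t (`|artanh u| + C * t) (C + C) phi) => //.
  - by rewrite addr_ge0// mulr_ge0.
  - by rewrite addr_ge0.
  move=> x y x0 xy yt.
  have xt : 0 <= x <= t by rewrite x0 (le_trans xy).
  have yt' : 0 <= y <= t by rewrite yt (le_trans x0).
  have -> : G y - G x = artanh (U y) * (phi y - phi x) +
     (artanh (U y) - artanh (U x)) * phi x +
     (ln (1 - U y ^+ 2) / 2 - ln (1 - U x ^+ 2) / 2) by rewrite /G; ring.
  apply: (le_trans (ler_normD _ _)); rewrite [(C + C) * _]mulrDl addrA lerD ?LQ//.
  apply: (le_trans (ler_normD _ _)).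
  rewrite [`|artanh (U y) * _|]normrM [`|_ * phi x|]normrM lerD//.
    by rewrite ler_wpM2r// Pbnd.
  rewrite -[leRHS]mulr1 ler_pM ?LP//.
  by rewrite ler_norml; apply: phi_itv.
move: dphi; apply: filterS; first exact: (ae_filter_ringOfSetsType lebesgue_measure).
move=> s dphi s0t; have dp := dphi s0t.
move: s0t; rewrite in_itv/= => /andP[s0 st].
have st' := ltW st.
have /andP[U1 U2] := tanh_momentum_itv st'.
(* At an interior time where the path touches [1] or [-1] it has an extremum. *)
have side : (-1 < phi s /\ phi s < 1) \/
    ((phi s = 1 \/ phi s = -1) /\ 'D_1 phi s = 0).
  have near_itv : \forall z \near s, -1 <= phi z <= 1.
    near=> z; apply: phi_itv; apply/andP; split; apply/ltW; near: z.
      exact: lt_nbhsr.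
    exact: lt_nbhsl.
  have /andP[p1 p2] : -1 <= phi s <= 1 by apply: phi_itv; rewrite !ltW.
  have [E|n1] := eqVneq (phi s) 1.
    right; split; first by left.
    apply: (derive_at_local_max (derivableP dp)).
    by apply: filterS near_itv => z /andP[]; rewrite E.
  have [E|n2] := eqVneq (phi s) (-1).
    right; split; first by right.
    apply: oppr_inj; rewrite oppr0.
    apply: (@derive_at_local_max _ (- phi) s); first exact: is_deriveN (derivableP dp).
    by apply: filterS near_itv => z /andP[? _] /=; rewrite !fctE E lerN2.
  by left; split; rewrite lt_neqAle; [rewrite eq_sym n2|rewrite n1].
have dG : is_derive s 1 G (artanh (U s) * 'D_1 phi s -
    (2 * U s ^+ 2 - 2 * phi s * U s) / (1 - U s ^+ 2)).
  have d1 := is_derive_momentum st'.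
  have d2 := is_derive_ln_momentum st'.
  have d3 := derivableP dp.
  rewrite /G; apply: is_derive_eq; rewrite /GRing.scale/=; ring.
split; first by apply: ex_derive.
- by rewrite derive_val; exact: legendre_le.
- (* The dual variable [0] shows that the Lagrangian is nonnegative. *)
  have := legendre_le (u := 0) _ _ side.
  rewrite /artanh addr0 subr0 divr1 ln1 !mul0r expr0n/= !mulr0 subr0 mul0r subr0.
  by apply; lra.
Unshelve. all: by end_near. Qed.
End Momentum.

(** * The extremal path *)

Section Extremal.
Context (R : realType) (t u : R).
Hypothesis t0 : 0 < t.
Hypothesis u1 : expR (4 * t) * u ^+ 2 < 1.

Let E := expR (4 * t).

(** The solution of the Euler-Lagrange equation [phi'' = 4 phi] that vanishes
    at [t] and whose conjugate momentum at time [0] is [artanh u]. *)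
Definition extremal (s : R) : R :=
  u * (expR (2 * s) - expR (4 * t) * expR (- (2 * s))) / (1 - expR (4 * t) * u ^+ 2).

Let dextremal (s : R) : R :=
  2 * u * (expR (2 * s) + E * expR (- (2 * s))) / (1 - E * u ^+ 2).

Let g0 : 0 < 1 - E * u ^+ 2. Proof. by rewrite subr_gt0. Qed.

Let is_derive_extremal (s : R) : is_derive s 1 extremal (dextremal s).
Proof.
rewrite /extremal /dextremal; apply: is_derive_eq; rewrite /GRing.scale/= -/E.
have g0E := g0; field; neq0.
Qed.

Let E1 : 1 < E. Proof. by rewrite /E expR_gt1 mulr_gt0. Qed.

Lemma extremal_start : extremal 0 = u * (1 - expR (4 * t)) / (1 - expR (4 * t) * u ^+ 2).
Proof. by rewrite /extremal mulr0 oppr0 expR0 mulr1. Qed.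

Lemma extremal_end : extremal t = 0.
Proof.
rewrite /extremal -expRD (_ : 4 * t - 2 * t = 2 * t); last by ring.
by rewrite subrr mulr0 mul0r.
Qed.

Let expR2_itv (s : R) : 0 <= s <= t -> 1 <= expR (2 * s) /\ expR (2 * s) ^+ 2 <= E.
Proof.
move=> /andP[s0 st]; split.
  by rewrite -[leLHS]expR0 ler_expR; lra.
by rewrite -expR4_sq ler_expR; lra.
Qed.

Lemma extremal_le (s : R) : 0 <= s <= t -> `|extremal s| <= `|extremal 0|.
Proof.
move=> st; have [x1 xE] := expR2_itv st.
rewrite extremal_start /extremal -/E expRN !normrM.
rewrite ler_wpM2r// ler_wpM2l//.
set x := expR (2 * s) in x1 xE *.
have x0 : 0 < x by lra.
rewrite !ler0_norm; last 2 first.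
- by rewrite subr_le0 ltW.
- by rewrite subr_le0 ler_pdivlMr// -expr2.
rewrite -subr_ge0.
have -> : - (1 - E) - - (x - E / x) = (x - 1) * (E + x) / x by field; neq0.
have e1 := E1; apply: divr_ge0; [apply: mulr_ge0; lra|exact: ltW].
Qed.

Let lipschitz_extremal (x y : R) : 0 <= x -> x <= y -> y <= t ->
  `|extremal y - extremal x| <= 4 * `|u| * E / (1 - E * u ^+ 2) * (y - x).
Proof.
apply: (@lipschitz_of_derive _ extremal dextremal) => // s st.
have [x1 xE] := expR2_itv st.
rewrite /dextremal !normrM normfV (gtr0_norm g0) normr_nat.
rewrite ler_wpM2r ?invr_ge0 ?(ltW g0)//.
rewrite -[4 * _ * _]mulrA (_ : 4 * (`|u| * E) = 2 * `|u| * (2 * E)); last by ring.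
rewrite ler_wpM2l// expRN; set z := expR (2 * s) in x1 xE *.
have z0 : 0 < z by lra.
have e1 := E1.
have h : E / z <= E by rewrite ler_pdivrMr//; nra.
have h' : z <= E by nra.
have h2 : 0 < E / z by apply: divr_gt0; lra.
by rewrite gtr0_norm; lra.
Qed.

Let has_derivative_extremal : has_derivative t extremal.
Proof.
split; last first.
  by apply: aeW => s _; apply: ex_derive.
apply: (@ac_of_increment_le _ 0 t 0 (4 * `|u| * E / (1 - E * u ^+ 2)) (cst 0)) => //.
- by apply: divr_ge0; [rewrite !mulr_ge0// expR_ge0|exact: ltW].
- move=> e e0; exists 1 => // n l r _ _ _.
  by rewrite big1// => i _; rewrite subrr normr0.
by move=> x y x0 xy yt; rewrite mul0r add0r; exact: lipschitz_extremal.
Qed.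

Let continuous_extremal : continuous extremal.
Proof.
by move=> s; apply: differentiable_continuous; apply/derivable1_diffP; apply: ex_derive.
Qed.

Let paths_extremal : `|extremal 0| <= 1 -> paths t extremal.
Proof.
move=> le1; split.
  split=> s _.
    by apply: cvg_at_right_filter; exact: continuous_extremal.
  apply/cvg_ex; exists (extremal s).
  by apply: cvg_at_left_filter; exact: continuous_extremal.
move=> s; rewrite !in_itv/= => st.
by rewrite -ler_norml (le_trans (extremal_le st)).
Qed.

(** Along the extremal path the duality bound is an equality at every time,
    and the integral of the Lagrangian is that of an exact derivative. *)
Lemma cost_extremal_le (J : R) : `|extremal 0| < 1 ->
  (cost J t 0 (extremal 0) <= (I_S J (extremal 0) +
    (ln ((1 - expR (4 * t) * u ^+ 2) / (1 - u ^+ 2)) / 2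
     - extremal 0 * artanh u))%:E)%E.
Proof.
move=> m1; apply: ereal_inf_lbound => /=.
exists extremal.
  by split; [apply: paths_extremal; exact: ltW|split => //; exact: extremal_end].
rewrite /path_rate; case: ifPn => [_|/asboolP//]; rewrite [RHS]EFinD; congr (_ + _)%E.
pose U (s : R) : R := u * expR (2 * s).
pose G (s : R) := artanh (U s) * extremal s + ln (1 - U s ^+ 2) / 2.
pose g (s : R) := artanh (U s) * dextremal s -
  (2 * U s ^+ 2 - 2 * extremal s * U s) / (1 - U s ^+ 2).
have Uitv s : s <= t -> -1 < U s < 1 by move=> st; exact: tanh_momentum_itv st.
have U0 : U 0 = u by rewrite /U mulr0 expR0 mulr1.
have Ut : U t ^+ 2 = E * u ^+ 2 by rewrite /U exprMn -expR4_sq mulrC.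
have uu : 0 < 1 - u ^+ 2.
  by have /andP[] := Uitv 0 (ltW t0); rewrite U0; nra.
have lagE s : 0 <= s <= t -> lagrangian (extremal s) ('D_1 extremal s) = g s.
  move=> st; have /andP[U1 U2] := Uitv s (proj2 (andP st)).
  have := le_lt_trans (extremal_le st) m1; rewrite ltr_norml => /andP[e1 e2].
  have := is_derive_extremal s => de; rewrite derive_val.
  apply: legendre_eq => //.
  rewrite /dextremal /U /extremal -/E expRN.
  have g0E := g0; have x0 := expR_gt0 (2 * s); field; neq0.
have dG s : s <= t -> is_derive s 1 G (g s).
  move=> st; have d1 := is_derive_momentum u1 st; have d2 := is_derive_ln_momentum u1 st.
  have d3 := is_derive_extremal s.
  rewrite /G /g -/(U s) in d1 d2 *; apply: is_derive_eq; rewrite /GRing.scale/=; ring.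
have cg : {within `[0, t], continuous g}.
  apply: derivable_within_continuous => s; rewrite in_itv/= => /andP[_ st].
  have /andP[U1 U2] := Uitv s st.
  have n0 : 1 - U s ^+ 2 != 0 by apply: lt0r_neq0; nra.
  have d1 := is_derive_momentum u1 st; have d3 := is_derive_extremal s.
  have d2 : is_derive s 1 U (2 * U s) by exact: is_derive_tanh_momentum.
  have d4 : derivable dextremal s 1 by rewrite /dextremal; apply: ex_derive.
  have d5 := derivableP d4.
  rewrite /g; apply: ex_derive.
rewrite (_ : integral _ _ _ =
   (\int[@lebesgue_measure R]_(s in `[0%R, t]) (g s)%:E)%E); last first.
  by apply: eq_integral => s; rewrite inE/= in_itv/= => st; rewrite lagE.
rewrite (@continuous_FTC2 _ g G 0 t t0 cg); last 2 first.
- split.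
  + by move=> s; rewrite in_itv/= => /andP[_ /ltW st]; have := dG s st => ?; apply: ex_derive.
  + apply: cvg_at_right_filter; apply: differentiable_continuous.
    by apply/derivable1_diffP; have := dG 0 (ltW t0) => ?; apply: ex_derive.
  + apply: cvg_at_left_filter; apply: differentiable_continuous.
    by apply/derivable1_diffP; have := dG t (lexx _) => ?; apply: ex_derive.
- move=> s; rewrite in_itv/= => /andP[_ /ltW st]; have := dG s st => ?.
  by rewrite derive1E derive_val.
rewrite -EFinB; congr EFin.
rewrite /G extremal_end mulr0 add0r Ut U0 ln_div ?posrE// -/E.
by field.
Qed.

End Extremal.

(** * The cost as a function of the initial magnetization *)

(** The value of the dual bound of [path_rate_ge] without the static term,
    with [E = exp (4 t)]. *)
Definition dual_cost (R : realType) (E m u : R) : R :=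
  ln ((1 - E * u ^+ 2) / (1 - u ^+ 2)) / 2 - m * artanh u.

(** The maximizer of [dual_cost E m]: the root of [E m u ^+ 2 - (E - 1) u - m
    = 0] of smaller modulus, written so that it makes sense at [m = 0]. *)
Definition tilt (R : realType) (E m : R) : R :=
  - (2 * m) / (E - 1 + Num.sqrt ((E - 1) ^+ 2 + 4 * E * m ^+ 2)).

Definition value (R : realType) (J E m : R) : R :=
  I_S J m + dual_cost E m (tilt E m).

Lemma cost_ge_dual (R : realType) (J t m u : R) : 0 <= t ->
  expR (4 * t) * u ^+ 2 < 1 ->
  ((I_S J m + dual_cost (expR (4 * t)) m u)%:E <= cost J t 0 m)%E.
Proof.
move=> t0 u1; apply/ereal_infP => _ [phi [p0 [phi0 phit]] <-].
exact: path_rate_ge.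
Qed.

Section Tilt.
Context (R : realType) (E : R).
Hypothesis E1 : 1 < E.

Let D m : R := E - 1 + Num.sqrt ((E - 1) ^+ 2 + 4 * E * m ^+ 2).

Let radicand_ge0 m : 0 <= (E - 1) ^+ 2 + 4 * E * m ^+ 2.
Proof. have e1 := E1; apply: addr_ge0; rewrite ?sqr_ge0//; nra. Qed.

Let D_gt0 m : 0 < D m.
Proof.
have e1 := E1; rewrite /D; have := sqrtr_ge0 ((E - 1) ^+ 2 + 4 * E * m ^+ 2); lra.
Qed.

Let D_sq m : D m ^+ 2 = 2 * (E - 1) * D m + 4 * E * m ^+ 2.
Proof.
rewrite {1 2}/D; set q := Num.sqrt _.
have q2 : q ^+ 2 = (E - 1) ^+ 2 + 4 * E * m ^+ 2 by rewrite sqr_sqrtr.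
rewrite (_ : (E - 1 + q) ^+ 2 = (E - 1) ^+ 2 + 2 * (E - 1) * q + q ^+ 2); last by ring.
rewrite q2; ring.
Qed.

Lemma tilt_quadratic m : E * m * tilt E m ^+ 2 - (E - 1) * tilt E m - m = 0.
Proof.
have d0 := D_gt0 m.
have -> : E * m * tilt E m ^+ 2 - (E - 1) * tilt E m - m =
  m * (2 * (E - 1) * D m + 4 * E * m ^+ 2 - D m ^+ 2) / D m ^+ 2.
  by rewrite /tilt -/(D m); field; neq0.
by rewrite D_sq subrr mulr0 mul0r.
Qed.

Lemma tilt_sq_lt m : E * tilt E m ^+ 2 < 1.
Proof.
have e1 := E1; have d0 := D_gt0 m.
rewrite /tilt -/(D m) expr_div_n mulrA ltr_pdivrMr ?exprn_gt0// D_sq mul1r.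
nra.
Qed.

Lemma tilt_itv m : -1 < tilt E m < 1.
Proof.
by have := tilt_sq_lt m; have e1 := E1 => h; apply/andP; split; nra.
Qed.

Lemma tiltN m : tilt E (- m) = - tilt E m.
Proof. by rewrite /tilt sqrrN mulrN !mulNr opprK. Qed.

Lemma tilt0 : tilt E 0 = 0.
Proof. by rewrite /tilt mulr0 oppr0 mul0r. Qed.

Lemma tilt_lt0 m : 0 < m -> tilt E m < 0.
Proof.
by move=> m0; rewrite /tilt -/(D m) mulNr oppr_lt0; apply: divr_gt0; rewrite ?mulr_gt0.
Qed.

Lemma tilt_continuous : continuous (tilt E).
Proof.
move=> m; rewrite /tilt.
apply: cvgM.
  by apply: cvgN; apply: cvgM; [exact: cvg_cst|exact: cvg_id].
apply: cvgV; first by rewrite gt_eqF// D_gt0.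
apply: cvgD; first exact: cvg_cst.
apply: continuous_comp; last exact: sqrt_continuous.
apply: cvgD; first exact: cvg_cst.
by apply: cvgM; [exact: cvg_cst|exact: exprn_continuous].
Qed.

(** The extremal path built on [tilt E m] starts at [m]. *)
Lemma tilt_start m : tilt E m * (1 - E) / (1 - E * tilt E m ^+ 2) = m.
Proof.
have h := tilt_sq_lt m; have q := tilt_quadratic m.
apply: (@mulIf _ (1 - E * tilt E m ^+ 2)); first by apply: lt0r_neq0; lra.
rewrite divfK; last by apply: lt0r_neq0; lra.
lra.
Qed.
End Tilt.

Lemma I_SN (R : realType) (J m : R) : I_S J (- m) = I_S J m.
Proof. by rewrite /I_S sqrrN opprK addrAC. Qed.

Lemma valueN (R : realType) (J E m : R) : 1 < E -> value J E (- m) = value J E m.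
Proof.
by move=> E1; rewrite /value I_SN /dual_cost tiltN// sqrrN artanhN ?tilt_itv// mulrNN.
Qed.

Lemma I_S0 (R : realType) (J : R) : I_S J 0 = 0.
Proof. by rewrite /I_S expr0n/= !(addr0, subr0, mulr0, mul0r, oppr0, ln1). Qed.

Lemma value0 (R : realType) (J E : R) : value J E 0 = 0.
Proof.
by rewrite /value I_S0 /dual_cost tilt0 expr0n/= !(subr0, mulr0, divr1, mul0r, ln1, addr0).
Qed.

Section Cost.
Context (R : realType) (J t : R).
Hypothesis t0 : 0 < t.
Let E := expR (4 * t).

Lemma expR4_gt1 : 1 < expR (4 * t).
Proof. by rewrite expR_gt1 mulr_gt0. Qed.

Lemma cost_ge_value m : ((value J E m)%:E <= cost J t 0 m)%E.
Proof. by apply: cost_ge_dual; [exact: ltW|exact/tilt_sq_lt/expR4_gt1]. Qed.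

Lemma cost_value m : -1 < m < 1 -> cost J t 0 m = (value J E m)%:E.
Proof.
move=> m1; apply/eqP; rewrite eq_le cost_ge_value andbT.
have h := tilt_sq_lt expR4_gt1 m.
have mE : extremal t (tilt E m) 0 = m by rewrite extremal_start; exact: tilt_start expR4_gt1 _.
have := cost_extremal_le t0 h J; rewrite mE; apply.
by rewrite ltr_norml.
Qed.

(** Freezing the dual variable at its optimal value for [m] and replacing the
    entropy by its tangent at [m] gives a lower bound for the cost at any
    other [m'], the endpoints included. It serves as a derivative of the
    cost: [artanh m - J m - artanh (tilt E m)] is its slope at [m]. *)
Lemma cost_ge_tangent (m m' : R) : -1 < m < 1 -> -1 <= m' <= 1 ->
  ((value J E m + (m' - m) *
     (artanh m - artanh (tilt E m) - J * (m + m') / 2))%:E <= cost J t 0 m')%E.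
Proof.
move=> /andP[m1 m2] /andP[m1' m2'].
have := cost_ge_dual J m' (ltW t0) (tilt_sq_lt expR4_gt1 m).
apply: le_trans; rewrite lee_fin /value /I_S /dual_cost -/E [artanh m]artanhE//.
have := @xlnx_tangent_le R (1 + m') (1 + m); have := @xlnx_tangent_le R (1 - m') (1 - m).
move=> /(_ ltac:(lra) ltac:(lra)) h1 /(_ ltac:(lra) ltac:(lra)) h2.
set L := ln (_ / _); set A := artanh _;
set p := ln (1 + m) in h1 h2 *; set q := ln (1 - m) in h1 h2 *.
set p' := ln (1 + m') in h1 h2 *; set q' := ln (1 - m') in h1 h2 *.
clearbody L A p q p' q'; lra.
Qed.

Let slope (m : R) := artanh m - J * m - artanh (tilt E m).

Lemma value_continuous m : -1 < m < 1 -> {for m, continuous (value J E)}.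
Proof.
move=> m1; have oi := tilt_itv expR4_gt1 m; have os := tilt_sq_lt expR4_gt1 m.
have oc := tilt_continuous expR4_gt1 (x := m).
have lnc (f : R -> R) : 0 < f m -> {for m, continuous f} ->
    {for m, continuous (fun x => ln (f x))}.
  by move=> f0 cf; apply: continuous_comp cf _; exact: continuous_ln.
have c1 : {for m, continuous (fun x : R => x)} by exact: cvg_id.
have cc (a : R) : {for m, continuous (fun _ : R => a)} by exact: cvg_cst.
rewrite /value /I_S /dual_cost.
case/andP: (m1) => m2 m3; case/andP: (oi) => o2 o3.
have e1 := expR4_gt1.
have CD (f g : R -> R) : {for m, continuous f} -> {for m, continuous g} ->
  {for m, continuous (fun x => f x + g x)} by exact: cvgD.
have CB (f g : R -> R) : {for m, continuous f} -> {for m, continuous g} ->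
  {for m, continuous (fun x => f x - g x)} by exact: cvgB.
have CM (f g : R -> R) : {for m, continuous f} -> {for m, continuous g} ->
  {for m, continuous (fun x => f x * g x)} by exact: cvgM.
have CN (f : R -> R) : {for m, continuous f} -> {for m, continuous (fun x => - f x)}.
  by exact: cvgN.
have CV (f : R -> R) : f m != 0 -> {for m, continuous f} ->
  {for m, continuous (fun x => (f x)^-1)} by exact: cvgV.
have cM1 : {for m, continuous (fun x : R => 1 + x)} by exact: CD _ _ (cc 1) c1.
have cM2 : {for m, continuous (fun x : R => 1 - x)} by exact: CB _ _ (cc 1) c1.
have cO2 : {for m, continuous (fun x : R => tilt E x ^+ 2)}.
  by apply: (@continuous_comp _ _ _ (tilt E) (fun x => x ^+ 2)) => //; exact: exprn_continuous.
have g1 : 0 < 1 + m by lra.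
have g2 : 0 < 1 - m by lra.
have cln1 := lnc (fun x => 1 + x) g1 cM1.
have cln2 := lnc (fun x => 1 - x) g2 cM2.
have cart := artanh_continuous_at oi oc.
have cq : {for m, continuous (fun x : R => (1 - E * tilt E x ^+ 2) / (1 - tilt E x ^+ 2))}.
  apply: (CM); first exact: CB _ _ (cc 1) (CM _ _ (cc E) cO2).
  apply: (CV); last exact: CB _ _ (cc 1) cO2.
  by apply: lt0r_neq0; nra.
have q0 : 0 < (1 - E * tilt E m ^+ 2) / (1 - tilt E m ^+ 2).
  by apply: divr_gt0; rewrite subr_gt0//; nra.
have clnq := lnc _ q0 cq.
have cm2 : {for m, continuous (fun x : R => x ^+ 2)} by exact: exprn_continuous.
apply: (CD); last exact: CB _ _ (CM _ _ clnq (cc 2^-1)) (CM _ _ c1 cart).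
apply: (CD); last exact: CM _ _ (CM _ _ cM2 (cc 2^-1)) cln2.
apply: (CD); last exact: CM _ _ (CM _ _ cM1 (cc 2^-1)) cln1.
exact: CN _ (CM _ _ (CM _ _ (cc J) cm2) (cc 2^-1)).
Qed.

Lemma slope_continuous m : -1 < m < 1 -> {for m, continuous slope}.
Proof.
move=> m1; rewrite /slope.
have c1 : {for m, continuous (fun x : R => x)} by exact: cvg_id.
have cc : {for m, continuous (fun _ : R => J)} by exact: cvg_cst.
have cid := artanh_continuous_at m1 c1.
have copt := artanh_continuous_at (tilt_itv expR4_gt1 m) (tilt_continuous expR4_gt1 (x := m)).
have cJ : {for m, continuous (fun x : R => J * x)} by exact: (cvgM cc c1).
have cd : {for m, continuous (fun x : R => artanh x - J * x)} by exact: (cvgB cid cJ).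
exact: (cvgB cd copt).
Qed.

(** At an interior minimum the tangent bounds based at nearby points on both
    sides force the slope to vanish, the slope being continuous. *)
Lemma slope_eq0_at_min m : 0 < J -> 0 < m < 1 ->
  (forall m', 0 < m' < 1 -> value J E m <= value J E m') -> slope m = 0.
Proof.
move=> J0 /andP[m0 m1] minm.
have m11 : -1 < m < 1 by lra.
have H m' : 0 < m' < 1 -> (m - m') * (slope m' - J * (m - m') / 2) <= 0.
  move=> /andP[m0' m1'].
  have m'11 : -1 < m' < 1 by lra.
  have := @cost_ge_tangent m' m m'11 ltac:(lra).
  rewrite cost_value// lee_fin => h.
  have := minm m' ltac:(lra).
  rewrite /slope; move: h; set A := artanh _; set B := artanh _.
  set V := value _ _ _; set V' := value _ _ _; clearbody A B V V'; lra.
have sc := slope_continuous m11.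
apply/eqP; apply: contrapT => /negP s0.
have e0 : 0 < `|slope m| / 4 by rewrite divr_gt0// normr_gt0.
have /cvgrPdist_lt /(_ _ e0) /nbhs_ballP[r /= r0 sr] := sc.
(* Small enough for the slope to vary little and for the quadratic error of the
   tangent bound to be absorbed, and to stay inside [(0, 1)]. *)
pose d := Num.min (r / 2) (Num.min (m / 2) (Num.min ((1 - m) / 2) (`|slope m| / (4 * J)))).
have d0 : 0 < d.
  rewrite /d !lt_min; apply/and4P; split; [lra|lra|lra|].
  by rewrite divr_gt0 ?normr_gt0 ?mulr_gt0.
have dr : d <= r / 2 by rewrite /d ge_min lexx.
have dm : d <= m / 2 by rewrite /d !ge_min lexx orbT.
have dm1 : d <= (1 - m) / 2 by rewrite /d !ge_min lexx !orbT.
have dJ : J * d <= `|slope m| / 4.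
  have : d <= `|slope m| / (4 * J) by rewrite /d !ge_min lexx !orbT.
  rewrite invfM mulrA ler_pdivlMr//; lra.
have [sp|sn] := ltP 0 (slope m).
- have h := H (m - d) ltac:(lra).
  have : `|slope m - slope (m - d)| < `|slope m| / 4.
    by apply: sr; rewrite /ball/= opprB addrC subrK gtr0_norm//; lra.
  rewrite (gtr0_norm sp) in dJ *; rewrite ltr_norml => /andP[h1 h2].
  move: h; rewrite (_ : m - (m - d) = d); last by ring.
  rewrite pmulr_rle0//; lra.
- have {}sn : slope m < 0 by rewrite lt_neqAle s0 sn.
  have h := H (m + d) ltac:(lra).
  have : `|slope m - slope (m + d)| < `|slope m| / 4.
    by apply: sr; rewrite /ball/= opprD addrA subrr add0r normrN gtr0_norm//; lra.
  rewrite (ltr0_norm sn) in dJ *; rewrite ltr_norml => /andP[h1 h2].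
  move: h; rewrite (_ : m - (m + d) = - d); last by ring.
  rewrite mulNr oppr_le0 pmulr_rge0//; lra.
Qed.

End Cost.

(** * Hyperbolic functions *)

Section Hyperbolic.
Context (R : realType).
Implicit Types x y : R.

Lemma cosh_gt0 x : 0 < cosh x.
Proof. by rewrite /cosh divr_gt0// addr_gt0 ?expR_gt0. Qed.

Lemma sinh0 : sinh 0 = 0 :> R.
Proof. by rewrite /sinh oppr0 subrr mul0r. Qed.

Lemma cosh0 : cosh 0 = 1 :> R.
Proof. by rewrite /cosh oppr0 expR0; lra. Qed.

Lemma cosh_sq x : cosh x ^+ 2 = 1 + sinh x ^+ 2.
Proof.
have e0 := expR_gt0 x.
by rewrite /cosh /sinh expRN; field; neq0.
Qed.

Lemma sinh_double x : sinh (2 * x) = 2 * sinh x * cosh x.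
Proof.
rewrite /sinh /cosh (_ : - (2 * x) = - x + - x); last by ring.
rewrite (_ : 2 * x = x + x); last by ring.
by rewrite !expRD; field.
Qed.

Lemma cosh_double x : cosh (2 * x) = cosh x ^+ 2 + sinh x ^+ 2.
Proof.
rewrite /sinh /cosh (_ : - (2 * x) = - x + - x); last by ring.
rewrite (_ : 2 * x = x + x); last by ring.
by rewrite !expRD; field.
Qed.

Lemma sinh_gt0 x : 0 < x -> 0 < sinh x.
Proof.
by move=> x0; rewrite /sinh divr_gt0// subr_gt0 ltr_expR; lra.
Qed.

Lemma sinh_lt_cosh x : sinh x < cosh x.
Proof. by rewrite /sinh /cosh; have := expR_gt0 (- x); lra. Qed.

Lemma cosh_gt1 x : 0 < x -> 1 < cosh x.
Proof.
move=> x0; have := sinh_gt0 x0; have := cosh_gt0 x; have := cosh_sq x; nra.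
Qed.
End Hyperbolic.

#[local] Instance is_derive_sinh (R : realType) (x : R) : is_derive x 1 (@sinh R) (cosh x).
Proof.
by rewrite /sinh /cosh; apply: is_derive_eq; rewrite /GRing.scale/=; ring.
Qed.

#[local] Instance is_derive_cosh (R : realType) (x : R) : is_derive x 1 (@cosh R) (sinh x).
Proof.
by rewrite /sinh /cosh; apply: is_derive_eq; rewrite /GRing.scale/=; ring.
Qed.

#[local] Instance is_derive_tanh (R : realType) (x : R) :
  is_derive x 1 (@tanh R) (1 / cosh x ^+ 2).
Proof.
have n0 : cosh x != 0 by rewrite gt_eqF// cosh_gt0.
rewrite /tanh; apply: is_derive_eq; rewrite /GRing.scale/=.
have := cosh_sq x => h.
transitivity ((cosh x ^+ 2 - sinh x ^+ 2) / cosh x ^+ 2); first by field.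
by rewrite h; congr (_ / _); ring.
Qed.

Section HyperbolicInequalities.
Context (R : realType).
Implicit Types x : R.

Lemma lt_sinh x : 0 < x -> x < sinh x.
Proof.
move=> x0; rewrite -subr_gt0 -[ltLHS](_ : sinh 0 - 0 = 0); last by rewrite sinh0 subrr.
apply: (@lt_of_derive_gt0 _ (fun x => sinh x - x) (fun x => cosh x - 1)) => //.
by move=> z /andP[z0 _]; rewrite subr_gt0 cosh_gt1.
Qed.

Lemma sinh_lt_mul_cosh x : 0 < x -> sinh x < x * cosh x.
Proof.
move=> x0; rewrite -subr_gt0.
have -> : 0 = 0 * cosh 0 - sinh 0 :> R by rewrite sinh0 mul0r subrr.
apply: (@lt_of_derive_gt0 _ (fun x => x * cosh x - sinh x) (fun x => x * sinh x)) => //.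
  by move=> z _; apply: is_derive_eq; rewrite /GRing.scale/=; ring.
by move=> z /andP[z0 _]; rewrite mulr_gt0// sinh_gt0.
Qed.

Lemma cosh_sub1_lt x : 0 < x -> 2 * (cosh x - 1) < x * sinh x.
Proof.
move=> x0; rewrite -subr_gt0.
have -> : 0 = 0 * sinh 0 - 2 * (cosh 0 - 1) :> R by rewrite cosh0 mul0r subrr mulr0 subr0.
apply: (@lt_of_derive_gt0 _ (fun x => x * sinh x - 2 * (cosh x - 1))
  (fun x => x * cosh x - sinh x)) => //.
  by move=> z _; apply: is_derive_eq; rewrite /GRing.scale/=; ring.
by move=> z /andP[z0 _]; rewrite subr_gt0 sinh_lt_mul_cosh.
Qed.

Lemma mul_tanh_lt_ln_cosh x : 0 < x -> x * tanh x < 2 * ln (cosh x).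
Proof.
move=> x0; rewrite -subr_gt0.
have -> : 0 = 2 * ln (cosh 0) - 0 * tanh 0 :> R by rewrite cosh0 ln1 mul0r mulr0 subr0.
apply: (@lt_of_derive_gt0 _ (fun x => 2 * ln (cosh x) - x * tanh x)
  (fun x => (sinh x * cosh x - x) / cosh x ^+ 2)) => //.
  move=> z _; have cz := cosh_gt0 z.
  have := is_derive_ln_comp (f := @cosh R) cz (is_derive_cosh z) => dl.
  apply: is_derive_eq; rewrite /GRing.scale/= /tanh; field; neq0.
move=> z /andP[z0 _]; apply: divr_gt0; last by rewrite exprn_gt0// cosh_gt0.
by have := lt_sinh z0; have := cosh_gt1 z0; nra.
Qed.
End HyperbolicInequalities.

Lemma artanh_tanh (R : realType) (x : R) : artanh (tanh x) = x.
Proof.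
have c0 := cosh_gt0 x; have e0 := expR_gt0 x.
have -> : artanh (tanh x) = ln (expR (2 * x)) / 2.
  rewrite /artanh; congr (ln _ / _).
  rewrite (_ : 2 * x = x + x); last by ring.
  rewrite expRD /tanh.
  have -> : (1 + sinh x / cosh x) = expR x / cosh x.
    apply: (@mulIf _ (cosh x)); first exact: lt0r_neq0.
    by rewrite mulrDl !divfK ?lt0r_neq0// /cosh /sinh; field.
  have -> : (1 - sinh x / cosh x) = expR (- x) / cosh x.
    apply: (@mulIf _ (cosh x)); first exact: lt0r_neq0.
    by rewrite mulrBl !divfK ?lt0r_neq0// /cosh /sinh; field.
  by rewrite expRN; field; neq0.
by rewrite expRK; field.
Qed.

(** * Critical points of the cost *)

Section Critical.
Context (R : realType) (J E m : R).
Let y := expR (2 * J * m).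
Let A := (1 - m) * y.
Let B := 1 + m.

Lemma aJ_expR : aJ J m * 2 * y = A * y - B.
Proof.
have y0 : 0 < y := expR_gt0 _.
by rewrite /aJ /sinh /cosh expRN -/y /A /B; field; neq0.
Qed.

Lemma tanh_expR : tanh (J * m) * (y + 1) = y - 1.
Proof.
have -> : y = expR (J * m) ^+ 2 by rewrite expr2 -expRD; congr expR; ring.
have w0 := expR_gt0 (J * m).
by rewrite /tanh /sinh /cosh expRN; field; neq0.
Qed.

(** In terms of [y = exp (2 J m)] the vanishing slope reads [tilt E m = (B -
    A) / (A + B)]; substituting in the quadratic equation of [tilt] leaves,
    up to the factor [1 - m ^+ 2], a relation that is affine in [E]. *)
Lemma critical_equation : 1 < E -> 0 < m -> m < 1 ->
  artanh m - J * m - artanh (tilt E m) = 0 -> E * (aJ J m - m) = aJ J m + m.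
Proof.
move=> E1 m0 m1 s0; have y0 : 0 < y := expR_gt0 _.
set U := tilt E m in s0; have /andP[U1 U2] : -1 < U < 1 by exact: tilt_itv.
have q : E * m * U ^+ 2 - (E - 1) * U - m = 0 by exact: tilt_quadratic.
have aJy := aJ_expR.
have lny : ln y = 2 * (J * m) by rewrite expRK mulrA.
have UE : (1 + U) / (1 - U) = (1 + m) / (1 - m) / y.
  apply: ln_inj; rewrite ?posrE ?divr_gt0 ?subr_gt0//; try lra.
  rewrite [RHS]ln_div ?posrE ?divr_gt0 ?subr_gt0 ?lny//; try lra.
  by move: s0; rewrite /artanh; lra.
have A0 : 0 < A by rewrite mulr_gt0// subr_gt0.
have B0 : 0 < B by rewrite /B; lra.
have UAB : U * (A + B) = B - A.
  have n1 : 0 < 1 - U by lra.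
  have n2 : 0 < 1 - m by lra.
  have : (1 + U) * A = B * (1 - U).
    apply: (@mulIf _ ((1 - U)^-1)); first by rewrite invr_eq0; exact: lt0r_neq0.
    rewrite mulfK; last exact: lt0r_neq0.
    by rewrite mulrAC UE /A /B; field; neq0.
  lra.
have AB0 : 0 < A + B by lra.
have {q} q : E * m * (B - A) ^+ 2 - (E - 1) * (B - A) * (A + B) - m * (A + B) ^+ 2 = 0.
  rewrite -UAB; transitivity ((A + B) ^+ 2 * (E * m * U ^+ 2 - (E - 1) * U - m)).
    by ring.
  by rewrite q mulr0.
have q2 : (1 - m ^+ 2) * (E * (A - B) * (1 + y) - (A + B) * (y - 1)) = 0.
  by apply: etrans q; rewrite /A /B; ring.
have m2 : 0 < 1 - m ^+ 2 by nra.
have {q2} q2 : E * (A - B) * (1 + y) = (A + B) * (y - 1).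
  by apply/eqP; rewrite -subr_eq0; move/eqP: q2; rewrite mulf_eq0 (gt_eqF m2).
apply: (@mulIf _ (2 * y)); first by apply: lt0r_neq0; lra.
have -> : E * (aJ J m - m) * (2 * y) = E * (aJ J m * 2 * y - 2 * m * y) by ring.
have -> : (aJ J m + m) * (2 * y) = aJ J m * 2 * y + 2 * m * y by ring.
rewrite aJy.
have -> : A * y - B - 2 * m * y = (A - B) * (1 + y) by rewrite /A /B; ring.
have -> : A * y - B + 2 * m * y = (A + B) * (y - 1) by rewrite /A /B; ring.
by rewrite mulrA.
Qed.

(** Conversely the relation makes [(B - A) / (A + B)] the negative root of
    the quadratic equation of [tilt]. Eliminating [E] shows that the value of
    the cost at a critical point depends on [J] and [m] only. *)
Lemma value_at_critical : 0 < J -> 1 < E -> 0 < m -> m < 1 ->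
  E * (aJ J m - m) = aJ J m + m -> value J E m = C_M J m.
Proof.
move=> J0 E1 m0 m1 eqa; have y0 : 0 < y := expR_gt0 _.
have y1 : 1 < y by rewrite expR_gt1 !mulr_gt0.
have aJy := aJ_expR; have th := tanh_expR.
have A0 : 0 < A by rewrite mulr_gt0// subr_gt0.
have B0 : 0 < B by rewrite /B; lra.
have AB0 : 0 < A + B by lra.
have q2 : E * (A - B) * (1 + y) = (A + B) * (y - 1).
  have -> : E * (A - B) * (1 + y) = E * (A * y - B - 2 * m * y) by rewrite /A /B; ring.
  have -> : (A + B) * (y - 1) = A * y - B + 2 * m * y by rewrite /A /B; ring.
  rewrite -aJy (_ : aJ J m * 2 * y - 2 * m * y = (aJ J m - m) * (2 * y)); last by ring.
  by rewrite mulrA eqa; ring.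
have AgtB : B < A.
  rewrite -subr_gt0; have : 0 < E * (A - B) * (1 + y) by rewrite q2 mulr_gt0// subr_gt0.
  rewrite pmulr_lgt0 ?pmulr_rgt0//; lra.
pose r := (B - A) / (A + B).
have r0 : r < 0 by rewrite pmulr_llt0 ?invr_gt0// subr_lt0.
have rq : E * m * r ^+ 2 - (E - 1) * r - m = 0.
  apply: (@mulIf _ ((A + B) ^+ 2)); first by rewrite lt0r_neq0// exprn_gt0.
  have -> : (E * m * r ^+ 2 - (E - 1) * r - m) * (A + B) ^+ 2 =
    (1 - m ^+ 2) * (E * (A - B) * (1 + y) - (A + B) * (y - 1)).
    by rewrite /r /A /B; field; move: AB0; rewrite /A /B => ?; neq0.
  by rewrite q2 subrr mulr0 mul0r.
have Ur : tilt E m = r.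
  have uq := tilt_quadratic E1 m; have u0 := tilt_lt0 E1 m0.
  set U := tilt E m in uq u0 *.
  have : (U - r) * (E * m * (U + r) - (E - 1)) = 0.
    by rewrite (_ : _ * _ = (E * m * U ^+ 2 - (E - 1) * U - m) - (E * m * r ^+ 2 - (E - 1) * r - m));
      [rewrite uq rq subrr|ring].
  move/eqP; rewrite mulf_eq0 subr_eq0 => /orP[/eqP//|/eqP h].
  have : E * m * (U + r) < 0 by rewrite pmulr_rlt0 ?mulr_gt0//; lra.
  lra.
have n1 : 0 < 1 - m by lra.
have n2 : 0 < 1 + m by lra.
have y10 : 0 < y + 1 by lra.
have rr : (1 + r) / (1 - r) = (1 + m) / (1 - m) / y.
  by rewrite /r /A /B; field; move: AB0 A0; rewrite /A /B => ? ?; neq0.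
have lnr : artanh r = (ln (1 + m) - ln (1 - m)) / 2 - J * m.
  rewrite /artanh rr ln_div ?posrE ?divr_gt0// ln_div ?posrE// /y expRK; lra.
have r2 : 1 - E * r ^+ 2 = 4 * y / ((A + B) * (1 + y)).
  have -> : E * r ^+ 2 = (E * (A - B) * (1 + y)) * (A - B) / ((A + B) ^+ 2 * (1 + y)).
    by rewrite /r; field; neq0.
  rewrite q2 /A /B; field; move: AB0; rewrite /A /B => ?; neq0.
have q0 : 0 < (1 - E * r ^+ 2) / (1 - r ^+ 2).
  have := tilt_sq_lt E1 m; have /andP[] := tilt_itv E1 m; rewrite Ur => o1 o2 o3.
  by apply: divr_gt0; rewrite subr_gt0//; nra.
have prod : (1 + m) * (1 - m) * ((1 - E * r ^+ 2) / (1 - r ^+ 2)) = 1 - m * tanh (J * m).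
  have -> : tanh (J * m) = (y - 1) / (y + 1) by rewrite -th mulfK// lt0r_neq0.
  have -> : 1 - r ^+ 2 = 4 * A * B / (A + B) ^+ 2 by rewrite /r; field; neq0.
  by rewrite r2 /A /B; field; move: AB0 A0; rewrite /A /B => ? ?; neq0.
rewrite /value /I_S /dual_cost Ur lnr /C_M -prod.
move: q0; set Q := (1 - E * r ^+ 2) / _; clearbody Q => Q0.
rewrite lnM ?posrE ?mulr_gt0// lnM ?posrE//.
by field.
Qed.
End Critical.

(** * Shape of the critical branch *)

(** A way of saying that [f] is positive first and negative afterwards which
    passes to primitives vanishing at [0] without naming the turning point. *)
Definition positive_then_negative (R : realType) (b : R) (f : R -> R) :=
  forall x y, 0 < x -> x < y -> y <= b -> f x <= 0 -> f y < 0.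

Lemma primitive_le0_derive_le0 (R : realType) (f df : R -> R) (b x : R) :
  f 0 = 0 -> (forall z, 0 <= z <= b -> is_derive z 1 f (df z)) ->
  0 < x -> x <= b -> f x <= 0 -> exists2 c, 0 < c < x & df c <= 0.
Proof.
move=> f0 fd x0 xb fx.
have [z /andP[z0 zx]|c cx] := @mean_value _ f df 0 x x0.
  by apply: fd; rewrite z0 (le_trans zx).
rewrite f0 !subr0 => fE; exists c => //.
by move: fx; rewrite fE pmulr_lle0.
Qed.

(** If [f x <= 0 = f 0], the derivative is nonpositive somewhere before [x],
    hence negative from there on. *)
Lemma positive_then_negative_primitive (R : realType) (f df : R -> R) (b : R) :
  f 0 = 0 -> (forall z, 0 <= z <= b -> is_derive z 1 f (df z)) ->
  positive_then_negative b df -> positive_then_negative b f.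
Proof.
move=> f0 fd dfP x y x0 xy yb fx.
have [c /andP[c0 cx] dc] := primitive_le0_derive_le0 f0 fd x0 (le_trans (ltW xy) yb) fx.
apply: lt_le_trans fx; apply: (gt_of_derive_lt0 xy (df := df)).
  by move=> z /andP[xz zy]; apply: fd; rewrite (le_trans (ltW x0) xz) (le_trans zy).
move=> z /andP[xz zy]; apply: (dfP c) => //; first exact: lt_trans xz.
by rewrite ltW// (lt_le_trans zy).
Qed.

Section Slope.
Context (R : realType) (J : R).
Implicit Types x y m : R.

(** With [y = 2 J m], this is [m ^+ 2] times the derivative of [aJ J m / m]
    and also, up to a positive factor, the derivative of [C_M J]: the two
    functions rise and fall together. *)
Definition branch_slope (y : R) : R :=
  y * cosh y - sinh y - y ^+ 2 / (2 * J) * sinh y.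

Let k (y : R) : R := (2 * J - 2) * sinh y - y * cosh y.
Let l (y : R) : R := (2 * J - 3) * cosh y - y * sinh y.

Let is_derive_k y : is_derive y 1 k (l y).
Proof. by rewrite /k /l; apply: is_derive_eq; rewrite /GRing.scale/=; ring. Qed.

Let is_derive_branch_slope y : 0 < J -> is_derive y 1 branch_slope (y / (2 * J) * k y).
Proof.
move=> J0; rewrite /branch_slope /k; apply: is_derive_eq; rewrite /GRing.scale/=.
by field; neq0.
Qed.

Let k0 : k 0 = 0.
Proof. by rewrite /k sinh0 mul0r mulr0 subrr. Qed.

Let branch_slope0 : branch_slope 0 = 0.
Proof. by rewrite /branch_slope sinh0 mul0r mulr0 !subr0. Qed.

Let l_pattern b : positive_then_negative b l.
Proof.
move=> x y x0 xy _; rewrite /l => lx.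
have y0 : 0 < y by exact: lt_trans xy.
have cx := cosh_gt0 x; have cy := cosh_gt0 y; have sx := sinh_gt0 x0; have sy := sinh_gt0 y0.
have sxy : sinh x * cosh y < sinh y * cosh x.
  rewrite -subr_gt0 (_ : _ - _ = sinh (y - x)) ?sinh_gt0 ?subr_gt0//.
  rewrite /sinh /cosh !opprB !expRB !expRN.
  have ex := expR_gt0 x; have ey := expR_gt0 y; field; neq0.
have : ((2 * J - 3) * cosh y - y * sinh y) * cosh x < 0.
  have h1 : ((2 * J - 3) * cosh x - x * sinh x) * cosh y <= 0 by rewrite pmulr_lle0.
  have h2 : x * (sinh x * cosh y) < x * (sinh y * cosh x) by rewrite ltr_pM2l.
  have h3 : x * (sinh y * cosh x) < y * (sinh y * cosh x) by rewrite ltr_pM2r// mulr_gt0.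
  lra.
by rewrite pmulr_llt0.
Qed.

(** The derivative of [branch_slope] is [y / (2 J)] times [k], and the
    derivative of [k] is [l], whose sign is that of [2 J - 3 - y tanh y]. *)
Lemma branch_slope_pattern b : 0 < J -> positive_then_negative b branch_slope.
Proof.
move=> J0; apply: (positive_then_negative_primitive branch_slope0
  (df := fun y => y / (2 * J) * k y)).
  by move=> z _; exact: is_derive_branch_slope.
have kP : positive_then_negative b k.
  by apply: (positive_then_negative_primitive k0 (df := l)).
move=> x y x0 xy yb.
have y0 : 0 < y by exact: lt_trans xy.
rewrite pmulr_rle0 ?divr_gt0 ?mulr_gt0// => kx.
by rewrite pmulr_rlt0 ?divr_gt0 ?mulr_gt0//; exact: (kP x y).
Qed.

Lemma branch_slope_lt0 y : 0 < J -> J <= 3 / 2 -> 0 < y -> branch_slope y < 0.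
Proof.
move=> J0 J32 y0; rewrite -branch_slope0.
apply: (gt_of_derive_lt0 y0 (df := fun y => y / (2 * J) * k y)).
  by move=> z _; exact: is_derive_branch_slope.
move=> z /andP[z0 _]; rewrite pmulr_rlt0 ?divr_gt0 ?mulr_gt0// -k0.
apply: (gt_of_derive_lt0 z0 (df := l)) => // w /andP[w0 _].
rewrite /l; have := mulr_gt0 w0 (sinh_gt0 w0).
have : (2 * J - 3) * cosh w <= 0 by rewrite pmulr_lle0 ?cosh_gt0//; lra.
lra.
Qed.

(** For [J > 3/2] the first term of [l] dominates near [0], since [tanh w <
    w]. *)
Lemma branch_slope_gt0 y : 0 < J -> 0 < y -> y ^+ 2 <= 2 * J - 3 -> 0 < branch_slope y.
Proof.
move=> J0 y0 y2; rewrite -branch_slope0.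
apply: (lt_of_derive_gt0 y0 (df := fun y => y / (2 * J) * k y)).
  by move=> z _; exact: is_derive_branch_slope.
move=> z /andP[z0 zy]; rewrite pmulr_rgt0 ?divr_gt0 ?mulr_gt0// -k0.
apply: (lt_of_derive_gt0 z0 (df := l)) => // w /andP[w0 wz].
have h := sinh_lt_mul_cosh w0; have cw := cosh_gt0 w.
rewrite /l subr_gt0; apply: (@lt_le_trans _ _ (w ^+ 2 * cosh w)).
  by rewrite expr2 -mulrA ltr_pM2l.
rewrite ler_pM2r//; apply: le_trans y2; nra.
Qed.

Lemma C_M_log_gt0 m : 0 <= m -> m <= 1 -> 0 < 1 - m * tanh (J * m).
Proof.
move=> m0 m1; have c0 := cosh_gt0 (J * m); have sc := sinh_lt_cosh (J * m).
rewrite /tanh mulrA subr_gt0 ltr_pdivrMr// mul1r.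
have [s0|s0] := leP 0 (sinh (J * m)); first by nra.
by apply: le_lt_trans c0; nra.
Qed.

Lemma is_derive_C_M m : 0 < J -> 0 <= m <= 1 -> is_derive m 1 (C_M J)
  (branch_slope (2 * (J * m)) / (4 * (1 - m * tanh (J * m)) * cosh (J * m) ^+ 2)).
Proof.
move=> J0 /andP[m0 m1]; have dom := C_M_log_gt0 m0 m1.
have d1 : is_derive m 1 (fun m => 1 - m * tanh (J * m))
    (- (tanh (J * m) + m * J / cosh (J * m) ^+ 2)).
  by apply: is_derive_eq; rewrite /GRing.scale/=; field; rewrite gt_eqF// cosh_gt0.
have := is_derive_ln_comp (f := fun m => 1 - m * tanh (J * m)) dom d1 => dl.
rewrite /C_M; apply: is_derive_eq; rewrite /GRing.scale/= /branch_slope.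
rewrite sinh_double cosh_double.
have c0 := cosh_gt0 (J * m); have cs := cosh_sq (J * m).
move: dom; rewrite /tanh; set c := cosh _ in c0 cs *; set s := sinh _ in cs *.
have -> : 1 - m * (s / c) = (c - m * s) / c by field; neq0.
move=> dom; have dom' : 0 < c - m * s by move: dom; rewrite pmulr_lgt0// invr_gt0.
apply/eqP; rewrite -subr_eq0; apply/eqP.
transitivity (J * m * (c ^+ 2 - 1 - s ^+ 2) / (2 * (c - m * s) * c)); last first.
  by rewrite cs (_ : 1 + s ^+ 2 - 1 - s ^+ 2 = 0) ?mulr0 ?mul0r//; ring.
field; neq0.
Qed.

Lemma C_M0 : C_M J 0 = 0.
Proof. by rewrite /C_M expr0n/= !(mulr0, mul0r) subr0 ln1 mul0r addr0. Qed.

Let C_M_denom m : 0 <= m -> m <= 1 ->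
  0 < (4 * (1 - m * tanh (J * m)) * cosh (J * m) ^+ 2)^-1.
Proof.
move=> m0 m1; rewrite invr_gt0; apply: mulr_gt0; last by rewrite exprn_gt0// cosh_gt0.
by apply: mulr_gt0 => //; exact: C_M_log_gt0.
Qed.

Let C_M_slope m : R :=
  branch_slope (2 * (J * m)) / (4 * (1 - m * tanh (J * m)) * cosh (J * m) ^+ 2).

Lemma C_M_le0_slope m : 0 < J -> 0 < m -> m <= 1 -> C_M J m <= 0 ->
  exists2 c, 0 < c < m & branch_slope (2 * (J * c)) <= 0.
Proof.
move=> J0 m0 m1 Cm.
have [|c /andP[c0 cm] Cc] :=
  primitive_le0_derive_le0 C_M0 (df := C_M_slope) (b := 1) _ m0 m1 Cm.
  by move=> z; exact: is_derive_C_M.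
exists c; first by rewrite c0.
have dc := C_M_denom (ltW c0) (le_trans (ltW cm) m1).
by move: Cc; rewrite /C_M_slope pmulr_lle0.
Qed.

Lemma C_M_pattern : 0 < J -> positive_then_negative 1 (C_M J).
Proof.
move=> J0; apply: (positive_then_negative_primitive C_M0 (df := C_M_slope)).
  by move=> z; exact: is_derive_C_M.
move=> x y x0 xy y1; have y0 : 0 < y by exact: lt_trans xy.
have dx := C_M_denom (ltW x0) (le_trans (ltW xy) y1).
have dy := C_M_denom (ltW y0) y1.
rewrite /C_M_slope pmulr_lle0// => hx; rewrite pmulr_llt0//.
apply: (@branch_slope_pattern (2 * (J * y)) J0 (2 * (J * x))) => //.
- by rewrite !mulr_gt0.
- by rewrite !ltr_pM2l.
Qed.

Lemma C_M_lt0 m : 0 < J -> J <= 3 / 2 -> 0 < m -> m <= 1 -> C_M J m < 0.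
Proof.
move=> J0 J32 m0 m1; rewrite -C_M0; apply: (gt_of_derive_lt0 m0 (df := C_M_slope)).
  by move=> z /andP[z0 zm]; apply: is_derive_C_M => //; rewrite z0 (le_trans zm).
move=> z /andP[z0 zm]; have dz := C_M_denom (ltW z0) (le_trans (ltW zm) m1).
by rewrite /C_M_slope pmulr_llt0// branch_slope_lt0// !mulr_gt0.
Qed.

Lemma C_M_gt0_near0 : 3 / 2 < J -> exists2 m, 0 < m < 1 & 0 < C_M J m.
Proof.
move=> J32; have J0 : 0 < J by lra.
have d0 : 0 < Num.sqrt (2 * J - 3) by rewrite sqrtr_gt0; lra.
(* The second entry is the range of [branch_slope_gt0]; the first keeps [m < 1]. *)
pose m := Num.min (1 / 2) (Num.sqrt (2 * J - 3) / (2 * J)).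
have m0 : 0 < m by rewrite lt_min divr_gt0//=; apply: divr_gt0 => //; lra.
have m1 : m <= 1 / 2 by rewrite ge_min lexx.
have md : 2 * (J * m) <= Num.sqrt (2 * J - 3).
  have : m <= Num.sqrt (2 * J - 3) / (2 * J) by rewrite ge_min lexx orbT.
  by rewrite ler_pdivlMr; [lra|lra].
exists m; first by apply/andP; split; lra.
rewrite -C_M0; apply: (lt_of_derive_gt0 m0 (df := C_M_slope)).
  by move=> z /andP[z0 zm]; apply: is_derive_C_M => //; apply/andP; split; lra.
move=> z /andP[z0 zm]; have dz : z <= 1 by lra.
have {}dz := C_M_denom (ltW z0) dz.
rewrite /C_M_slope pmulr_lgt0//.
have yz : 0 < 2 * (J * z) by rewrite !mulr_gt0.
apply: branch_slope_gt0 => //.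
have h : 2 * (J * z) <= Num.sqrt (2 * J - 3).
  by apply: le_trans md; rewrite !ler_pM2l// ltW.
have <- : Num.sqrt (2 * J - 3) ^+ 2 = 2 * J - 3 by rewrite sqr_sqrtr//; lra.
by rewrite ler_sqr// nnegrE ltW.
Qed.

Lemma C_M1_lt0 : 0 < J -> C_M J 1 < 0.
Proof.
move=> J0; rewrite /C_M expr1n !mulr1 mul1r.
have c0 := cosh_gt0 J; have c1 := cosh_gt1 J0.
have -> : 1 - tanh J = expR (- J) / cosh J.
  rewrite /tanh -{1}(@divff _ (cosh J)) ?gt_eqF// -mulrBl; congr (_ / _).
  by rewrite /cosh /sinh; field.
rewrite ln_div ?posrE ?expR_gt0// expRK.
by have := ln_gt0 c1; lra.
Qed.

(** A magnetization [m > 0] is critical at time [t] exactly when this equals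
    [coth (2 t)]. *)
Definition branch_ratio (m : R) : R := aJ J m / m.

Lemma is_derive_branch_ratio m : 0 < J -> 0 < m ->
  is_derive m 1 branch_ratio (branch_slope (2 * (J * m)) / m ^+ 2).
Proof.
move=> J0 m0; have n0 : m != 0 by exact: lt0r_neq0.
have n0' : id m != 0 by [].
have dV : is_derive m 1 (fun z : R => z^-1) (- m ^- 2 *: 1) by exact: is_deriveV.
rewrite /branch_ratio /aJ; apply: is_derive_eq; rewrite /GRing.scale/= /branch_slope -!mulrA.
by rewrite /sinh /cosh; field; neq0.
Qed.

(** If [C_M J] is not positive at [m], it has begun to decrease before [m];
    the derivative of [branch_ratio] has the same sign, so it decreases from
    there on too. Hence among critical points with nonpositive cost there is
    at most one for each time. *)
Lemma branch_ratio_decreasing m m' : 0 < J -> 0 < m -> m < m' -> m' <= 1 ->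
  C_M J m <= 0 -> branch_ratio m' < branch_ratio m.
Proof.
move=> J0 m0 mm' m1 Cm.
have [c /andP[c0 cm] Sc] := C_M_le0_slope J0 m0 (le_trans (ltW mm') m1) Cm.
apply: (gt_of_derive_lt0 mm' (df := fun m => branch_slope (2 * (J * m)) / m ^+ 2)).
  by move=> z /andP[mz _]; apply: is_derive_branch_ratio => //; exact: lt_le_trans mz.
move=> z /andP[mz _]; have z0 : 0 < z by exact: lt_trans mz.
rewrite pmulr_llt0 ?invr_gt0 ?exprn_gt0//.
apply: (@branch_slope_pattern (2 * (J * z)) J0 (2 * (J * c))) => //.
- by rewrite !mulr_gt0.
- by rewrite !ltr_pM2l// (lt_trans cm).
Qed.

Lemma branch_ratio_lt m : 0 < J -> J <= 3 / 2 -> 0 < m -> branch_ratio m < 2 * J - 1.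
Proof.
move=> J0 J32 m0; rewrite /branch_ratio ltr_pdivrMr// -subr_gt0.
have -> : 0 = (2 * J - 1) * 0 - aJ J 0 by rewrite /aJ !mulr0 sinh0 mul0r !subr0.
apply: (@lt_of_derive_gt0 _ (fun m => (2 * J - 1) * m - aJ J m)
  (fun m => 2 * J * m * sinh (2 * J * m) - (2 * J - 1) * (cosh (2 * J * m) - 1))) => //.
  by move=> z _; rewrite /aJ; apply: is_derive_eq; rewrite /GRing.scale/=; ring.
move=> z /andP[z0 _]; have y0 : 0 < 2 * J * z by rewrite !mulr_gt0.
rewrite subr_gt0; apply: le_lt_trans (cosh_sub1_lt y0).
by rewrite ler_pM2r ?subr_gt0 ?cosh_gt1//; lra.
Qed.

Lemma branch_ratio1_lt1 : branch_ratio 1 < 1.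
Proof.
by rewrite /branch_ratio divr1 /aJ mulr1 mul1r; have := sinh_lt_cosh (2 * J); lra.
Qed.

(** A zero of [C_M J] is reached by the branch of critical points at a finite
    time. If [branch_ratio J m <= 1] then [tanh (J m) <= m]; bounding the
    logarithm in [C_M J m] by its tangent at [1 / cosh (J m) ^+ 2] gives, for
    fixed [J m], an expression that is affine and decreasing in [m], and
    [mul_tanh_lt_ln_cosh] makes it negative at [m = tanh (J m)]. *)
Lemma branch_ratio_gt1 m : 0 < J -> 0 < m -> m <= 1 -> 0 <= C_M J m -> 1 < branch_ratio m.
Proof.
move=> J0 m0 m1 Cm; rewrite /branch_ratio ltr_pdivlMr// mul1r ltNge; apply/negP => am.
have x0 : 0 < J * m by rewrite mulr_gt0.
have c0 := cosh_gt0 (J * m); have s0 := sinh_gt0 x0; have cs := cosh_sq (J * m).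
have sm : sinh (J * m) <= m * cosh (J * m).
  move: am; rewrite /aJ -mulrA sinh_double cosh_double.
  set s := sinh _ in s0 cs *; set c := cosh _ in c0 cs *.
  nra.
have dom := C_M_log_gt0 (ltW m0) m1.
have xt := mul_tanh_lt_ln_cosh x0.
(* For this product [ln z <= z - 1] is the tangent bound. *)
have z0 : 0 < (1 - m * tanh (J * m)) * cosh (J * m) ^+ 2 by rewrite mulr_gt0 ?exprn_gt0.
have := ln_le_sub1 z0.
rewrite lnM ?posrE ?exprn_gt0// lnXn// => h.
have h2 : J * m ^+ 2 + ln (1 - m * tanh (J * m)) < 0.
  have xs := lt_sinh x0; have c1 := cosh_gt1 x0.
  move: h xt; rewrite /tanh; set s := sinh _ in s0 cs sm xs *; set c := cosh _ in c0 c1 cs sm *.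
  have -> : (1 - m * (s / c)) * c ^+ 2 - 1 = s * (s - m * c).
    transitivity (c ^+ 2 - m * s * c - 1); first by field; neq0.
    by rewrite cs; ring.
  set L := ln _; set L' := ln c => h xt.
  have xt' : J * m * s < 2 * L' * c by move: xt; rewrite mulrA ltr_pdivrMr.
  have xsc : J * m <= s * c by nra.
  have : (J * m ^+ 2 + L) * c < 0.
    have h' : L * c <= (s * (s - m * c) - 2 * L') * c by rewrite ler_pM2r//; lra.
    have : (m * c - s) * (J * m - s * c) <= 0.
      by rewrite mulr_ge0_le0; lra.
    nra.
  by rewrite pmulr_llt0.
by move: Cm; rewrite /C_M; lra.
Qed.

Lemma branch_ratio_continuous m : 0 < J -> 0 < m -> {for m, continuous branch_ratio}.
Proof.
move=> J0 m0; apply: differentiable_continuous; apply/derivable1_diffP.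
have := is_derive_branch_ratio J0 m0 => ?; exact: ex_derive.
Qed.

Lemma branch_ratio_surj M th : 0 < J -> 0 < M -> M < 1 -> 1 < th -> th < branch_ratio M ->
  exists2 m, M < m < 1 & branch_ratio m = th.
Proof.
move=> J0 M0 M1 th1 thM.
have [||c cM cE] := @IVT _ branch_ratio M 1 th (ltW M1).
- apply: continuous_in_subspaceT => z; rewrite inE/= in_itv/= => /andP[Mz _].
  by apply: branch_ratio_continuous => //; exact: lt_le_trans Mz.
- by rewrite ge_min le_max (ltW thM)/= (ltW (lt_trans branch_ratio1_lt1 th1)) orbT.
exists c => //; move: cM; rewrite in_itv/= => /andP[Mc c1].
rewrite !lt_neqAle Mc c1 !andbT; apply/andP; split; apply/eqP => E.
  by move: thM; rewrite E cE ltxx.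
by move: th1; rewrite -cE E; have := branch_ratio1_lt1; lra.
Qed.

(** The limit of [branch_ratio J] at [0] is [2 J - 1]. *)
Lemma branch_ratio_gt_near0 th : 0 < J -> 1 < th -> th < 2 * J - 1 ->
  exists2 m, 0 < m < 1 & th < branch_ratio m.
Proof.
move=> J0 th1 thJ.
have q1 : 1 < 2 * J - th by lra.
(* Chosen so that [cosh y <= exp x < 2 J - th] for [y = 2 J m <= x]. *)
pose x := ln (2 * J - th) / 2; have lx := ln_gt0 q1.
pose m := Num.min (1 / 2) (x / (2 * J)).
have x0 : 0 < x by rewrite divr_gt0.
have m0 : 0 < m by rewrite lt_min; apply/andP; split; [lra|apply: divr_gt0; lra].
have m1 : m <= 1 / 2 by rewrite ge_min lexx.
have mx : 2 * J * m <= x.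
  have : m <= x / (2 * J) by rewrite ge_min lexx orbT.
  by rewrite ler_pdivlMr; [lra|lra].
exists m; first by apply/andP; split; lra.
rewrite /branch_ratio ltr_pdivlMr// /aJ.
have y0 : 0 < 2 * J * m by rewrite !mulr_gt0.
have := lt_sinh y0.
have : cosh (2 * J * m) < 2 * J - th.
  apply: (@le_lt_trans _ _ (expR x)).
    rewrite /cosh; have : expR (- (2 * J * m)) <= expR (2 * J * m) by rewrite ler_expR; lra.
    have : expR (2 * J * m) <= expR x by rewrite ler_expR.
    lra.
  rewrite -[ltRHS]lnK ?posrE; last by lra.
  by rewrite ltr_expR /x; lra.
rewrite -(ltr_pM2l m0); lra.
Qed.
End Slope.

(** [C_M J] vanishes at [0], is positive nearby and negative at [1], and
    cannot become positive again. *)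
Lemma C_M_zeros_unique (R : realType) (J : R) : 3 / 2 < J ->
  C_M_zeros J = [set m_star J] /\ 0 < m_star J < 1.
Proof.
move=> J32; have J0 : 0 < J by lra.
have [a /andP[a0 a1] Ca] := C_M_gt0_near0 J32.
have C1 := C_M1_lt0 J0.
have [||z zI zE] := @IVT _ (C_M J) a 1 0 (ltW a1).
- apply: derivable_within_continuous => x; rewrite in_itv/= => /andP[ax x1].
  have := is_derive_C_M (m := x) J0 => H.
  have ? := H ltac:(apply/andP; split; lra).
  exact: ex_derive.
- by rewrite ge_min le_max (ltW Ca) (ltW C1) orbT.
move: zI; rewrite in_itv/= => /andP[az z1].
have z0 : 0 < z by exact: lt_le_trans az.
have zz : C_M_zeros J z by split => //; rewrite z0.
have uniq x : C_M_zeros J x -> x = z.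
  move=> [/andP[x0 x1] xE]; have [h|h|//] := ltgtP x z.
  - by have := C_M_pattern J0 x0 h z1; rewrite xE lexx zE ltxx => /(_ isT).
  - by have := C_M_pattern J0 z0 h x1; rewrite zE lexx xE ltxx => /(_ isT).
have mz : m_star J = z.
  by rewrite /m_star; case: xgetP => [x _ /uniq//|/(_ z)].
rewrite mz; split; first by apply/seteqP; split => x /=; [exact: uniq|move=> ->].
rewrite z0 /= lt_neqAle z1 andbT; apply/eqP => E.
by move: C1; rewrite -E zE ltxx.
Qed.

(** * Minimizers at a fixed time *)

(** [coth (2 t)]. *)
Definition coth2 (R : realType) (t : R) : R := (expR (4 * t) + 1) / (expR (4 * t) - 1).

Section Time.
Context (R : realType).
Implicit Types s t rho : R.

Lemma coth2_gt1 t : 0 < t -> 1 < coth2 t.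
Proof.
move=> t0; have e1 := expR4_gt1 t0.
by rewrite /coth2 ltr_pdivlMr; lra.
Qed.

Lemma coth2_decreasing s t : 0 < s -> s < t -> coth2 t < coth2 s.
Proof.
move=> s0 st; have t0 : 0 < t by exact: lt_trans st.
have e1 := expR4_gt1 t0; have e2 := expR4_gt1 s0.
have es : expR (4 * s) < expR (4 * t) by rewrite ltr_expR ltr_pM2l.
rewrite /coth2; set a := expR _ in e1 es *; set b := expR _ in e2 es *.
rewrite ltr_pdivrMr; last by lra.
rewrite mulrAC ltr_pdivlMr; last by lra.
lra.
Qed.

Lemma half_arccoth_gt0 rho : 1 < rho -> 0 < arccoth rho / 2.
Proof.
move=> r1; rewrite /arccoth !divr_gt0//; apply: ln_gt0.
by rewrite ltr_pdivlMr; lra.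
Qed.

Lemma coth2_arccoth rho : 1 < rho -> coth2 (arccoth rho / 2) = rho.
Proof.
move=> r1; rewrite /coth2 /arccoth.
rewrite (_ : 4 * (_ / 2 / 2) = ln ((rho + 1) / (rho - 1))); last by field.
rewrite lnK ?posrE; last by apply: divr_gt0; lra.
by field; apply/andP; split; apply: lt0r_neq0; lra.
Qed.

Lemma coth2_branch_ratio (J t m : R) : 0 < t -> 0 < m ->
  expR (4 * t) * (aJ J m - m) = aJ J m + m <-> branch_ratio J m = coth2 t.
Proof.
move=> t0 m0; have e1 := expR4_gt1 t0; rewrite /branch_ratio /coth2.
set E := expR _ in e1 *; set a := aJ J m.
have E0 : E - 1 != 0 by apply: lt0r_neq0; lra.
have m0' : m != 0 by exact: lt0r_neq0.
split=> h.
- by apply/eqP; rewrite eqr_div//; apply/eqP; lra.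
- by move/eqP: h; rewrite eqr_div// => /eqP; lra.
Qed.
End Time.

(** At time [0] a path of finite cost must start at its end. *)
Lemma minimizers_at_0 (R : realType) (J : R) : minimizers J 0 0 = [set 0].
Proof.
have costoo (m : R) : m != 0 -> cost J 0 0 m = +oo%E.
  move=> m0; rewrite /cost (_ : [set phi | _] = set0) ?image_set0 ?ereal_inf0//.
  by apply/seteqP; split=> // phi [_ [p0 p0']]; move/eqP: m0; apply; rewrite -p0.
have cost0 : (cost J 0 0 0 < +oo)%E.
  apply: (@le_lt_trans _ _ (path_rate J 0 (cst 0))).
    apply: ereal_inf_lbound; exists (cst 0) => //; split; last by [].
    split; first by split=> s _; [exact: cvg_cst|exact: is_cvg_cst].
    by move=> s _; rewrite /= in_itv/=; apply/andP; split; lra.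
  rewrite /path_rate; case: ifPn => [_|/asboolP []].
    by rewrite set_itv1 integral_set1 adde0 ltry.
  split; last by apply: aeW => s _; exact: derivable_cst.
  move=> e e0; exists 1 => // n l r _ _ _.
  by rewrite big1// => i _; rewrite subrr normr0.
apply/seteqP; split=> m /=.
- move=> [_ /(_ 0)]; have [->//|/costoo ->] := eqVneq m 0.
  rewrite in_itv/= => /(_ ltac:(apply/andP; split; lra)).
  by rewrite leye_eq => /eqP E; move: cost0; rewrite E.
- move=> ->; split; first by rewrite in_itv/=; apply/andP; split; lra.
  by move=> m' _; have [->//|/costoo ->] := eqVneq m' 0; rewrite leey.
Qed.

Section GlobalMinimum.
Context (R : realType) (J t : R).
Local Notation V := (value J (expR (4 * t))).

(** This keeps minimizers away from the endpoints, where [value] is merely a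
    lower bound for the cost: at [tanh J] the slope of the entropy is [J],
    large enough for the tangent bound to increase all the way to [1]. *)
Lemma cost_gt_value_tanh m : 0 < J -> 0 < t -> tanh J < `|m| -> `|m| <= 1 ->
  ((V (tanh J))%:E < cost J t 0 m)%E.
Proof.
move=> J0 t0; set b := tanh J.
have E1 := expR4_gt1 t0.
have b0 : 0 < b by rewrite divr_gt0 ?sinh_gt0 ?cosh_gt0.
have b1 : b < 1 by rewrite /b /tanh ltr_pdivrMr ?cosh_gt0// mul1r sinh_lt_cosh.
have ab : artanh b = J by exact: artanh_tanh.
have u0 := tilt_lt0 E1 b0; have /andP[u1 u2] := tilt_itv E1 b.
have A0 := artanh_lt0 u1 u0.
have bb : -1 < b < 1 by lra.
have Nbb : -1 < - b < 1 by lra.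
have [m0|m0] := leP 0 m.
- rewrite ger0_norm// => bm m1.
  apply: lt_le_trans (cost_ge_tangent J t0 (m := b) (m' := m) bb ltac:(lra)).
  rewrite lte_fin ltrDl mulr_gt0 ?subr_gt0// ab.
  have : J * (b + m) <= J * 2 by rewrite ler_pM2l//; lra.
  lra.
- rewrite ltr0_norm// => bm m1.
  apply: lt_le_trans (cost_ge_tangent J t0 (m := - b) (m' := m) Nbb ltac:(lra)).
  rewrite valueN// lte_fin ltrDl nmulr_rgt0; last by lra.
  rewrite artanhN ?bb// tiltN artanhN ?u1// ab.
  have : J * (b - m) <= J * 2 by rewrite ler_pM2l//; lra.
  lra.
Qed.

(** Compactness of [[0, tanh J]] and parity reduce the minimization of the
    cost to that of the explicit function [value] on the open interval. *)
Lemma minimizers_value : 0 < J -> 0 < t ->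
  exists m0, [/\ 0 <= m0, m0 < 1,
    forall m, -1 < m < 1 -> V m0 <= V m &
    minimizers J t 0 = [set m | -1 < m < 1 /\ V m = V m0]].
Proof.
move=> J0 t0; set b := tanh J.
have E1 := expR4_gt1 t0.
have b0 : 0 < b by rewrite divr_gt0 ?sinh_gt0 ?cosh_gt0.
have b1 : b < 1 by rewrite /b /tanh ltr_pdivrMr ?cosh_gt0// mul1r sinh_lt_cosh.
have [|m0 m0I minV] := @EVT_min _ (V) 0 b (ltW b0).
  apply: continuous_in_subspaceT => m; rewrite inE/= in_itv/= => /andP[m0 mb].
  by apply: value_continuous => //; lra.
move: m0I; rewrite in_itv/= => /andP[m00 m0b].
have m01 : m0 < 1 by exact: le_lt_trans b1.
have Vabs m : V `|m| = V m by case: ger0P => // _; rewrite valueN.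
have Vb : V m0 <= V b by apply: minV; rewrite in_itv/= lexx ltW.
have out m : b < `|m| -> `|m| <= 1 -> ((V m0)%:E < cost J t 0 m)%E.
  move=> bm m1; apply: le_lt_trans (cost_gt_value_tanh J0 t0 bm m1).
  by rewrite lee_fin.
have inn m : `|m| <= b -> V m0 <= V m.
  by move=> mb; rewrite -(Vabs m); apply: minV; rewrite in_itv/= normr_ge0.
have minV' m : -1 < m < 1 -> V m0 <= V m.
  move=> m1; have [/inn//|bm] := leP `|m| b.
  have := out m bm; rewrite cost_value// lte_fin => h; apply/ltW/h.
  by rewrite ltW// ltr_norml.
have m011 : -1 < m0 < 1 by lra.
exists m0; split => //.
apply/seteqP; split => m /=.
- move=> [m1 /(_ m0)]; rewrite in_itv/= in m1.
  rewrite in_itv/= (cost_value J t0 m011) => /(_ ltac:(lra)) cm.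
  have [mb|bm] := leP `|m| b; last first.
    by move: (out m bm); rewrite ler_norml m1 => /(_ isT); rewrite ltNge cm.
  have mm : -1 < m < 1 by rewrite -ltr_norml; exact: le_lt_trans b1.
  split => //; apply/eqP; rewrite eq_le minV'// andbT -lee_fin -cost_value//.
- move=> [m1 Vm]; split; first by rewrite in_itv/= -ler_norml ltW// ltr_norml.
  move=> m'; rewrite in_itv/= => m1'; rewrite cost_value// Vm.
  have [mb|bm] := leP `|m'| b.
    by apply: le_trans (cost_ge_value _ _ _) => //; rewrite lee_fin inn.
  by apply/ltW/out => //; rewrite ler_norml.
Qed.

(** The only positive magnetizations that can minimize: critical at time [t],
    and with a value not above the value [0] taken at [0]. *)
Definition critical (m : R) := branch_ratio J m = coth2 t /\ C_M J m <= 0.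

Lemma value_branch_ratio m : 0 < J -> 0 < t -> 0 < m -> m < 1 ->
  branch_ratio J m = coth2 t -> V m = C_M J m.
Proof.
move=> J0 t0 m0 m1 /(coth2_branch_ratio J t0 m0) h.
by apply: value_at_critical => //; exact: expR4_gt1.
Qed.

Lemma positive_minimizer_critical m : 0 < J -> 0 < t -> 0 < m < 1 ->
  (forall m', -1 < m' < 1 -> V m <= V m') -> critical m.
Proof.
move=> J0 t0 m01 minm; have /andP[m0 m1] := m01.
have E1 := expR4_gt1 t0.
have s0 : artanh m - J * m - artanh (tilt (expR (4 * t)) m) = 0.
  apply: (slope_eq0_at_min t0 J0 m01) => m' /andP[m0' m1'].
  by apply: minm; lra.
have := critical_equation E1 m0 m1 s0 => /(coth2_branch_ratio J t0 m0) h.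
split => //; rewrite -(value_branch_ratio J0 t0 m0 m1 h) -(value0 J (expR (4 * t))).
by apply: minm; lra.
Qed.

Lemma critical_unique m m' : 0 < J -> 0 < m < 1 -> 0 < m' < 1 ->
  critical m -> critical m' -> m = m'.
Proof.
move=> J0 /andP[m0 m1] /andP[m0' m1'] [r1 c1] [r2 c2].
have [mm|mm|//] := ltgtP m m'.
- by have := branch_ratio_decreasing J0 m0 mm (ltW m1') c1; rewrite r1 r2 ltxx.
- by have := branch_ratio_decreasing J0 m0' mm (ltW m1) c2; rewrite r1 r2 ltxx.
Qed.

Lemma minimizers_no_critical : 0 < J -> 0 < t ->
  (forall m, 0 < m < 1 -> ~ critical m) -> minimizers J t 0 = [set 0].
Proof.
move=> J0 t0 nc; have E1 := expR4_gt1 t0.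
have [m0 [m00 m01 minV ->]] := minimizers_value J0 t0.
have pos m : -1 < m < 1 -> V m = V m0 -> m <= 0.
  move=> m1 Vm; rewrite leNgt; apply/negP => mp.
  have mm : 0 < m < 1 by lra.
  by apply: (nc m) => //; apply: positive_minimizer_critical => //; rewrite Vm.
have {}m0E : m0 = 0 by apply/eqP; rewrite eq_le m00 pos//; lra.
rewrite m0E in minV pos *; apply/seteqP; split => m /=.
- move=> [m1 Vm]; apply/eqP; rewrite eq_le pos//= -oppr_le0 pos ?valueN//; lra.
- by move=> ->; split => //; lra.
Qed.

Lemma minimizers_negative_critical m : 0 < J -> 0 < t -> 0 < m < 1 ->
  branch_ratio J m = coth2 t -> C_M J m < 0 -> minimizers J t 0 = [set m; - m].
Proof.
move=> J0 t0 m01 rm Cm; have E1 := expR4_gt1 t0.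
have /andP[mp m1] := m01.
have [m0 [m00 m0lt minV ->]] := minimizers_value J0 t0.
have Vm := value_branch_ratio J0 t0 mp m1 rm.
have cm : critical m by split => //; exact: ltW.
have neg : V m0 < 0 by apply: le_lt_trans (minV m ltac:(lra)) _; rewrite Vm.
have pos z : -1 < z < 1 -> V z = V m0 -> 0 < z -> z = m.
  move=> z1 Vz zp; have z01 : 0 < z < 1 by lra.
  by apply: (critical_unique J0) => //; apply: positive_minimizer_critical => //; rewrite Vz.
have n0 z : V z = V m0 -> z <> 0 by move=> Vz z0; move: neg; rewrite -Vz z0 value0 ltxx.
have m0p : 0 < m0 by rewrite lt_neqAle m00 andbT eq_sym; apply/eqP/n0.
have m0E : m0 = m by apply: pos => //; lra.
rewrite m0E in n0 pos *; apply/seteqP; split => z /=.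
- move=> [z1 Vz]; have [zp|zn|z0] := ltgtP 0 z.
  + by left; exact: pos.
  + by right; apply: oppr_inj; rewrite opprK; apply: pos; rewrite ?valueN//; lra.
  + by case: (n0 z Vz).
- by case=> ->; rewrite ?valueN//; split => //; lra.
Qed.

Lemma minimizers_zero_critical m : 0 < J -> 0 < t -> 0 < m < 1 ->
  branch_ratio J m = coth2 t -> C_M J m = 0 -> minimizers J t 0 = [set 0; m; - m].
Proof.
move=> J0 t0 m01 rm Cm; have E1 := expR4_gt1 t0.
have /andP[mp m1] := m01.
have [m0 [m00 m0lt minV ->]] := minimizers_value J0 t0.
have Vm : V m = 0 by rewrite (value_branch_ratio J0 t0 mp m1 rm).
have cm : critical m by split => //; rewrite Cm.
have pos z : -1 < z < 1 -> V z = V m0 -> 0 < z -> z = m.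
  move=> z1 Vz zp; have z01 : 0 < z < 1 by lra.
  by apply: (critical_unique J0) => //; apply: positive_minimizer_critical => //; rewrite Vz.
have V0 : V m0 = 0.
  have [m0z|m0p] := eqVneq m0 0; first by rewrite m0z value0.
  by rewrite (pos m0) ?lt_neqAle ?m00 1?eq_sym ?m0p//; lra.
rewrite V0 in pos *; apply/seteqP; split => z /=.
- move=> [z1 Vz]; have [zp|zn|z0] := ltgtP 0 z.
  + by left; right; exact: pos.
  + by right; apply: oppr_inj; rewrite opprK; apply: pos; rewrite ?valueN//; lra.
  + by left; left.
- by case=> [[]|] ->; rewrite ?valueN ?value0//; split => //; lra.
Qed.
End GlobalMinimum.

(** * The minimizer as a function of time *)

Lemma continuous_ray_of_segments (R : realType) (a : R) (f : R -> R) :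
  (forall b, a < b -> {within `[a, b], continuous f}) ->
  {within `[a, +oo[, continuous f}.
Proof.
move=> fab; apply/subspace_continuousP => x /=; rewrite in_itv/= andbT => ax.
have axx : a < x + 1 by lra.
have /subspace_continuousP /(_ x) := fab _ axx.
rewrite /= in_itv/= ax/= => /(_ ltac:(lra)) H.
apply: cvg_trans H; apply: cvg_app.
rewrite /within/= => P [e /= e0 eP].
exists (Num.min e 1); first by rewrite /= lt_min e0/=.
move=> y /=; rewrite lt_min => /andP[ye y1]; rewrite in_itv/= andbT => ay.
apply: eP => //=; rewrite in_itv/= ay/=.
by move: y1; rewrite ltr_norml; lra.
Qed.

(** A strictly decreasing [rho] that takes each value between [1] and [coth
    (2 Psi)] can be solved for [m] in terms of the time. A strictly
    increasing function with the intermediate value property is continuous. *)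
Lemma inverse_branch (R : realType) (rho : R -> R) (Psi M : R) :
  0 < Psi ->
  (forall m, M < m -> m < 1 -> rho m < coth2 Psi) ->
  (forall m m', M < m -> m < m' -> m' < 1 -> rho m' < rho m) ->
  (forall th, 1 < th -> th < coth2 Psi -> exists2 m, M < m < 1 & rho m = th) ->
  exists mhat : R -> R,
    [/\ forall t, Psi < t -> M < mhat t < 1 /\ rho (mhat t) = coth2 t,
        {within `[Psi, +oo[, continuous mhat},
        {in `[Psi, +oo[ &, {homo mhat : s t / s < t}} &
        mhat Psi = M].
Proof.
move=> P0 rlt rdec rsurj.
pose mhat t := if Psi < t then xget M [set m | M < m < 1 /\ rho m = coth2 t] else M.
have mP t : Psi < t -> M < mhat t < 1 /\ rho (mhat t) = coth2 t.
  move=> Pt; rewrite /mhat Pt; case: xgetP => [m _ //|no].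
  have [m mM mE] := rsurj (coth2 t) (coth2_gt1 (lt_trans P0 Pt)) (coth2_decreasing P0 Pt).
  by case: (no m).
have mPsi : mhat Psi = M by rewrite /mhat ltxx.
have inj m m' : M < m < 1 -> M < m' < 1 -> rho m = rho m' -> m = m'.
  move=> /andP[a1 a2] /andP[b1 b2] E.
  have [h|h|//] := ltgtP m m'.
  - by have := rdec _ _ a1 h b2; rewrite E ltxx.
  - by have := rdec _ _ b1 h a2; rewrite E ltxx.
have inc s t : Psi <= s -> s < t -> mhat s < mhat t.
  move=> Ps st; have Pt : Psi < t by exact: le_lt_trans st.
  have [/andP[t1 t2] tE] := mP t Pt.
  move: Ps; rewrite le_eqVlt => /predU1P[<-|Ps]; first by rewrite mPsi.
  have [/andP[s1 s2] sE] := mP s Ps.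
  have lt := coth2_decreasing (lt_trans P0 Ps) st.
  rewrite ltNge le_eqVlt; apply/negP => /predU1P[E|h].
    by move: lt; rewrite -tE -sE E ltxx.
  have := rdec _ _ t1 h s2; rewrite sE tE => h'.
  by move: (lt_trans lt h'); rewrite ltxx.
exists mhat; split => //; last first.
  move=> s t; rewrite !in_itv/= !andbT => Ps Pt; exact: inc.
apply: continuous_ray_of_segments => b Pb.
apply: segment_inc_surj_continuous.
  apply: le_mono_in => s t; rewrite !in_itv/= => /andP[Ps _] _; exact: inc.
move=> y /=; rewrite in_itv/= mPsi => /andP[]; rewrite le_eqVlt => /predU1P[<- _|My yb].
  by exists Psi => //=; rewrite in_itv/= lexx ltW.
have [/andP[b1 b2] bE] := mP b Pb.
have y1 : y < 1 by exact: le_lt_trans b2.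
have cb1 := coth2_gt1 (lt_trans P0 Pb).
have ry : coth2 b <= rho y.
  move: yb; rewrite le_eqVlt => /predU1P[->|yb]; first by rewrite bE.
  by rewrite -bE; apply/ltW/rdec.
have r1 : 1 < rho y by exact: lt_le_trans ry.
pose s := arccoth (rho y) / 2.
have s0 : 0 < s by exact: half_arccoth_gt0.
have sE : coth2 s = rho y by exact: coth2_arccoth.
have Ps : Psi < s.
  rewrite ltNge; apply/negP => h; have := rlt _ My y1; rewrite -sE ltNge => /negP; apply.
  move: h; rewrite le_eqVlt => /predU1P[->//|h]; exact/ltW/coth2_decreasing.
have sb : s <= b.
  rewrite leNgt; apply/negP => h.
  by have := coth2_decreasing (lt_trans P0 Pb) h; rewrite sE ltNge ry.
exists s; first by rewrite /= in_itv/= sb ltW.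
have [sM sE'] := mP s Ps.
by apply: inj => //; [rewrite My|rewrite sE' sE].
Qed.

Theorem theorem2 (R : realType) (J : R) (hJ : 0 < J) :
  (J <= 1 -> forall t : R, 0 <= t -> minimizers J t 0 = [set 0])
  /\
  (1 < J -> J <= 3 / 2 ->
    (forall t : R, 0 <= t -> t <= Psi_c J -> minimizers J t 0 = [set 0]) /\
    exists mhat : R -> R,
      (forall t : R, Psi_c J < t ->
         0 < mhat t /\ minimizers J t 0 = [set mhat t; - mhat t]) /\
      {within `[Psi_c J, +oo[, continuous mhat} /\
      {in `[Psi_c J, +oo[ &, {homo mhat : s t / s < t}} /\
      mhat (Psi_c J) = 0)
  /\
  (3 / 2 < J ->
    C_M_zeros J = [set m_star J] /\
    (forall t : R, 0 <= t -> t < Psi_c J -> minimizers J t 0 = [set 0]) /\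
    exists mhat : R -> R,
      (forall t : R, Psi_c J < t ->
         0 < mhat t /\ minimizers J t 0 = [set mhat t; - mhat t]) /\
      minimizers J (Psi_c J) 0 =
        [set 0; mhat (Psi_c J); - mhat (Psi_c J)] /\
      {within `[Psi_c J, +oo[, continuous mhat} /\
      {in `[Psi_c J, +oo[ &, {homo mhat : s t / s < t}} /\
      mhat (Psi_c J) = m_star J /\ 0 < m_star J).
Proof.
have coth2_le (s t : R) : 0 < s -> s <= t -> coth2 t <= coth2 s.
  by move=> s0; rewrite le_eqVlt => /predU1P[->//|st]; exact/ltW/coth2_decreasing.
split; [|split].
- move=> J1 t; rewrite le_eqVlt => /predU1P[<-|t0]; first exact: minimizers_at_0.
  apply: minimizers_no_critical => // m /andP[m0 _] [rm _].
  have := branch_ratio_lt hJ (ltac:(lra) : J <= 3 / 2) m0; rewrite rm.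
  by have := coth2_gt1 t0; lra.
- move=> J1 J32.
  have PE : Psi_c J = arccoth (2 * J - 1) / 2 by rewrite /Psi_c J32.
  have r1 : 1 < 2 * J - 1 by lra.
  have P0 : 0 < Psi_c J by rewrite PE; exact: half_arccoth_gt0.
  have cP : coth2 (Psi_c J) = 2 * J - 1 by rewrite PE; exact: coth2_arccoth.
  split.
    move=> t; rewrite le_eqVlt => /predU1P[<- _|t0 tP]; first exact: minimizers_at_0.
    apply: minimizers_no_critical => // m /andP[m0 _] [rm _].
    have := branch_ratio_lt hJ J32 m0; rewrite rm -cP ltNge; case/negP; exact: coth2_le.
  have [|||mhat [mP mc mi m0]] := @inverse_branch R (branch_ratio J) (Psi_c J) 0 P0.
  + by move=> m m0 _; rewrite cP; exact: branch_ratio_lt.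
  + move=> m m' m0 mm m1; apply: branch_ratio_decreasing => //; first exact: ltW.
    by apply/ltW/C_M_lt0 => //; apply/ltW/(lt_trans mm).
  + move=> th th1; rewrite cP => thJ.
    have [a /andP[a0 a1] ath] := branch_ratio_gt_near0 hJ th1 thJ.
    have [m /andP[am m1] mE] := branch_ratio_surj hJ a0 a1 th1 ath.
    by exists m => //; rewrite (lt_trans a0).
  exists mhat; split => // t Pt.
  have [m01 mE] := mP t Pt; have /andP[mp m1] := m01.
  split => //; apply: minimizers_negative_critical => //; first exact: lt_trans Pt.
  by apply: C_M_lt0 => //; exact: ltW.
- move=> J32; have [CZ /andP[s0 s1]] := C_M_zeros_unique J32.
  have Cs : C_M J (m_star J) = 0 by have [] : C_M_zeros J (m_star J) by rewrite CZ.
  have PE : Psi_c J = arccoth (branch_ratio J (m_star J)) / 2.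
    by rewrite /Psi_c leNgt J32.
  have r1 : 1 < branch_ratio J (m_star J).
    by apply: branch_ratio_gt1 => //; [exact: ltW|rewrite Cs].
  have P0 : 0 < Psi_c J by rewrite PE; exact: half_arccoth_gt0.
  have cP : coth2 (Psi_c J) = branch_ratio J (m_star J) by rewrite PE; exact: coth2_arccoth.
  have Cneg m : m_star J < m -> m <= 1 -> C_M J m < 0.
    by move=> sm m1; apply: (C_M_pattern hJ s0 sm m1); rewrite Cs.
  split=> //; split.
    move=> t; rewrite le_eqVlt => /predU1P[<- _|t0 tP]; first exact: minimizers_at_0.
    apply: minimizers_no_critical => // m /andP[m0 m1] [rm Cm].
    have lt : branch_ratio J (m_star J) < branch_ratio J m.
      by rewrite rm -cP; exact: coth2_decreasing.
    have [h|h|E] := ltgtP (m_star J) m.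
    + have := branch_ratio_decreasing hJ s0 h (ltW m1); rewrite Cs lexx => /(_ isT).
      by rewrite ltNge ltW.
    + by have := C_M_pattern hJ m0 h (ltW s1) Cm; rewrite Cs ltxx.
    + by move: lt; rewrite E ltxx.
  have [|||mhat [mP mc mi m0]] := @inverse_branch R (branch_ratio J) (Psi_c J) (m_star J) P0.
  + by move=> m sm m1; rewrite cP; apply: branch_ratio_decreasing => //; [exact: ltW|rewrite Cs].
  + move=> m m' sm mm m1; apply: branch_ratio_decreasing => //; first exact: lt_trans sm.
      exact: ltW.
    by apply/ltW/Cneg => //; apply/ltW/(lt_trans mm).
  + by move=> th th1; rewrite cP => thJ; exact: branch_ratio_surj.
  exists mhat; split.
    move=> t Pt; have [/andP[sm m1] mE] := mP t Pt.
    have mp : 0 < mhat t by exact: lt_trans sm.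
    split => //; apply: minimizers_negative_critical => //.
    * exact: lt_trans Pt.
    * by rewrite mp.
    * by apply: Cneg => //; exact: ltW.
  split=> //; rewrite m0; apply: minimizers_zero_critical => //.
  by rewrite s0.
Qed.
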